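(* Let $X$ be a nonempty compact metrizable space, $\varphi:X\to X$ a continuous, locally injective surjection, $F:X\to\mathbb R$ continuous, and $\beta\in\mathbb R\setminus\{0\}$. Assume that there is a $\beta$-KMS state for $\alpha^F$. Set $$m=\lim_{n\to\infty}\frac1n\log\left(\min_{x\in X}\#\varphi^{-n}(x)\right),\qquad M=\lim_{n\to\infty}\frac1n\log\left(\max_{x\in X}\#\varphi^{-n}(x)\right).$$ Then there is a $\varphi$-invariant Borel probability measure $\mu$ on $X$ such that $$\beta\int_X F\,d\mu\in[m,M].$$
   Context: $\mathbb N=\{0,1,2,\dots\}$. Locally injective means that the topology of $X$ has a basis consisting of sets on which $\varphi$ is injective. Groupoid: $\Gamma_\varphi=\{(x,k,y)\in X\times\mathbb Z\times X:\exists a,b\in\mathbb N,\ k=a-b,\ \varphi^a(x)=\varphi^b(y)\}$, with product $(x,k,y)(y,k',y')=(x,k+k',y')$ and inverse $(x,k,y)^{-1}=(y,-k,x)$. For $k\in\mathbb Z$ and $n\in\mathbb N$ with $n+k\ge 0$ let $\Gamma_\varphi(k,n)=\{(x,l,y)\in X\times\mathbb Z\times X: l=k,\ \varphi^{k+i}(x)=\varphi^i(y)\ \text{for all } i\ge n\}$ with the relative topology from $X\times\mathbb Z\times X$; $\Gamma_\varphi(k,n)$ is open in $\Gamma_\varphi(k,n+1)$. $\Gamma_\varphi(k)=\bigcup_{n}\Gamma_\varphi(k,n)$ has the inductive limit topology, and $\Gamma_\varphi=\bigsqcup_k\Gamma_\varphi(k)$ has the topology in which each $\Gamma_\varphi(k)$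 is open and closed. The unit space is identified with $X$ via $x\mapsto(x,0,x)$. Algebras: $\mathrm{alg}^*\Gamma_\varphi$ is the $*$-algebra of functions on $\Gamma_\varphi$ generated by the continuous compactly supported functions under the convolution $f\star g(x,k,y)=\sum_{z,\,n+l=k}f(x,n,z)g(z,l,y)$ and the involution $f^*(x,k,y)=\overline{f(y,-k,x)}$. $C^*_r(\Gamma_\varphi)$ is its completion in the reduced norm $\|f\|=\sup_{x\in X}\|\pi_x(f)\|$, where $\pi_x$ is the representation on $\ell^2(\{(z,k,y)\in\Gamma_\varphi:y=x\})$ given by $(\pi_x(f)\xi)(\gamma)=\sum_{\gamma_1\gamma_2=\gamma}f(\gamma_1)\xi(\gamma_2)$. $D=D_{\Gamma_\varphi}$ is the closure in $C^*_r(\Gamma_\varphi)$ of the set of elements of $\mathrm{alg}^*\Gamma_\varphi$ supported in the unit space; it is an abelian $C^*$-algebra of bounded functions on $X$ (supremum norm) containing $C(X)$. $V_\varphi\in C^*_r(\Gamma_\varphi)$ is the isometry $V_\varphi(x,k,y)=(\#\varphi^{-1}(\varphi(x)))^{-1/2}$ if $k=1$ and $y=\varphi(x)$, and $0$ otherwise; $C^*_r(\Gamma_\varphi)$ is generated by $D$ and $V_\varphi$. For real-valued $F\in D$, $\alpha^F:\mathbb R\to\mathrm{Aut}\,C^*_r(\Gamma_\varphi)$ is the continuous action with $\alpha^F_t(d)=d$ for $d\in D$ and $\alpha^F_t(V_\varphi)=e^{iFt}V_\varphi$. For $\beta\in\mathbb R\setminus\{0\}$ a $\beta$-KMS state for $\alpha^F$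 is a state $\omega$ of $C^*_r(\Gamma_\varphi)$ with $\omega(xy)=\omega(y\,\alpha^F_{i\beta}(x))$ for all $\alpha^F$-analytic $x,y$. *)

(* Defs.v *)
From HB Require Import structures.
From mathcomp Require Import all_boot all_order all_algebra.
From mathcomp Require Import complex finmap.
From mathcomp Require Import all_classical all_reals all_analysis.

Set Implicit Arguments.
Unset Strict Implicit.
Unset Printing Implicit Defensive.

Import Order.TTheory GRing.Theory Num.Theory.
Import numFieldNormedType.Exports.

Local Open Scope classical_set_scope.
Local Open Scope ring_scope.
Local Open Scope complex_scope.

(* The base point only records nonemptiness; measurable types need it. *)
#[short(type="pointedMetricType")]
HB.structure Definition PointedMetric (K : numDomainType) :=
  { M of Metric K M & isPointed M }.

(* A plain record: HB cannot join normed modules and algebras after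
   numDomainType has been declared. *)
Record unitalCstarAlgebra (R : realType) := UnitalCstarAlgebra {
  cstar_space :> completeNormedModType R[i] ;
  cstar_one : cstar_space ;
  cstar_mul : cstar_space -> cstar_space -> cstar_space ;
  cstar_adj : cstar_space -> cstar_space ;
  cstar_mulA : associative cstar_mul ;
  cstar_mul1 : left_id cstar_one cstar_mul ;
  cstar_mulr1 : right_id cstar_one cstar_mul ;
  cstar_mulDl : left_distributive cstar_mul +%R ;
  cstar_mulDr : right_distributive cstar_mul +%R ;
  cstar_scaleAl : forall (z : R[i]) a b,
    z *: cstar_mul a b = cstar_mul (z *: a) b ;
  cstar_scaleAr : forall (z : R[i]) a b,
    z *: cstar_mul a b = cstar_mul a (z *: b) ;
  cstar_adjK : involutive cstar_adj ;
  cstar_adjD : {morph cstar_adj : a b / a + b} ;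
  cstar_adjZ : forall (z : R[i]) a, cstar_adj (z *: a) = z^* *: cstar_adj a ;
  cstar_adjM : forall a b,
    cstar_adj (cstar_mul a b) = cstar_mul (cstar_adj b) (cstar_adj a) ;
  cstar_normM : forall a b, `|cstar_mul a b| <= `|a| * `|b| ;
  cstar_identity : forall a, `|cstar_mul (cstar_adj a) a| = `|a| ^+ 2
}.

Arguments cstar_one {R _}.
Arguments cstar_mul {R _}.
Arguments cstar_adj {R _}.

Notation "a \** b" := (cstar_mul a b) (at level 40, left associativity).

Definition locally_injective (X : topologicalType) (phi : X -> X) :=
  exists2 B : set (set X), basis B & forall U, B U -> set_inj U phi.

(* The cardinality of phi^{-n}(x), which is finite for the maps at hand. *)
Definition npreimages (X : choiceType) (phi : X -> X) (n : nat) (x : X) : nat :=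
  #|` fset_set [set y : X | iter n phi y = x]|%fset.

Section groupoid.
Variables (X : topologicalType) (phi : X -> X).

Definition in_gpd (x : X) (k : int) (y : X) : Prop :=
  exists a b : nat, k = a%:Z - b%:Z /\ iter a phi x = iter b phi y.

Record gpd : Type := Gpd {
  gpd_val : X * discrete_topology int * X ;
  gpd_valP : `[< in_gpd gpd_val.1.1 gpd_val.1.2 gpd_val.2 >]
}.

HB.instance Definition _ := [isSub for gpd_val].
HB.instance Definition _ := [Choice of gpd by <:].

Definition rng (g : gpd) : X := (gpd_val g).1.1.
Definition lag (g : gpd) : int := (gpd_val g).1.2.
Definition src (g : gpd) : X := (gpd_val g).2.

Definition gpd_prod (g1 g2 g : gpd) : Prop :=
  [/\ src g1 = rng g2, rng g = rng g1, lag g = lag g1 + lag g2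
    & src g = src g2].

Lemma gpd_inv_subproof (g : gpd) : `[< in_gpd (src g) (- lag g) (rng g) >].
Proof.
apply/asboolP; have /asboolP[a [b [kE abE]]] := gpd_valP g.
by exists b, a; split; [rewrite /lag kE opprB|rewrite /rng /src abE].
Qed.

Definition gpd_inv (g : gpd) : gpd :=
  @Gpd (src g, - lag g, rng g) (gpd_inv_subproof g).

Definition is_unit (g : gpd) : Prop := lag g = 0 /\ rng g = src g.

(* The stratum Gamma_phi(k,n), for 0 <= n + k; then k + i >= 0 for i >= n,
   so that the absolute value is harmless. *)
Definition stratum (k : int) (n : nat) : set gpd :=
  [set g | lag g = k /\ forall i : nat, (n <= i)%N ->
     iter (absz (k + i%:Z)) phi (rng g) = iter i phi (src g)].

(* Disjoint union over k of the inductive limits over n: a set is open iff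
   its trace on every stratum is relatively open in X * Z * X. *)
Definition gpd_open (U : set gpd) : Prop :=
  forall (k : int) (n : nat), 0 <= n%:Z + k ->
    exists2 W : set (X * discrete_topology int * X), open W
      & U `&` stratum k n = gpd_val @^-1` W `&` stratum k n.

Lemma gpd_openT : gpd_open setT.
Proof. by move=> k n _; exists setT => //; exact: openT. Qed.

Lemma gpd_openI : setI_closed gpd_open.
Proof.
move=> U V oU oV k n kn; have [W1 oW1 UE] := oU k n kn.
have [W2 oW2 VE] := oV k n kn; exists (W1 `&` W2); first exact: openI.
by rewrite preimage_setI setIIl UE VE -setIIl.
Qed.

Lemma gpd_open_bigcup (I : Type) (U : I -> set gpd) :
  (forall i, gpd_open (U i)) -> gpd_open (\bigcup_i U i).
Proof.
move=> oU k n kn.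
have /choice[W WE] : forall i, exists W : set (X * discrete_topology int * X),
    open W /\ U i `&` stratum k n = gpd_val @^-1` W `&` stratum k n.
  by move=> i; have [W ? ?] := oU i k n kn; exists W.
exists (\bigcup_i W i); first by apply: bigcup_open => i _; have [] := WE i.
rewrite preimage_bigcup !setI_bigcupl; apply: eq_bigcupr => i _.
by have [] := WE i.
Qed.

HB.instance Definition _ :=
  isOpenTopological.Build gpd gpd_openT gpd_openI gpd_open_bigcup.

End groupoid.

Section algebras.
Variables (R : realType) (X : topologicalType) (phi : X -> X).
Local Notation Gamma := (gpd phi).
Local Notation C := R[i].

(* A sum with infinite support is 0; for the functions of [alg] every sum
   below has finite support. *)
Definition convolution (f1 f2 : Gamma -> C) (g : Gamma) : C :=
  \sum_(p \in [set p : Gamma * Gamma | gpd_prod p.1 p.2 g]) (f1 p.1 * f2 p.2).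

Definition invol (f : Gamma -> C) (g : Gamma) : C := (f (gpd_inv g))^*.

Definition Cc : set (Gamma -> C) :=
  [set f | continuous (f : Gamma -> C^o) /\
           compact (closure [set g | f g != 0])].

Inductive alg : set (Gamma -> C) :=
| alg_Cc f : Cc f -> alg f
| alg_add f1 f2 : alg f1 -> alg f2 -> alg (fun g => f1 g + f2 g)
| alg_scale (z : C) f : alg f -> alg (fun g => z * f g)
| alg_convolution f1 f2 : alg f1 -> alg f2 -> alg (convolution f1 f2)
| alg_invol f : alg f -> alg (invol f).

Definition l2norm (xi : Gamma -> C) : \bar R :=
  sqrte (\esum_(g in [set: Gamma]) (complex.Re (`|xi g| ^+ 2))%:E).

Definition l2_ball (x : X) : set (Gamma -> C) :=
  [set xi | (forall g, src g <> x -> xi g = 0) /\ (l2norm xi <= 1)%E].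

(* The operator pi_x(f) on l^2 of the source fibre of x is xi |-> convolution f xi. *)
Definition rep_norm (x : X) (f : Gamma -> C) : \bar R :=
  ereal_sup [set l2norm (convolution f xi) | xi in l2_ball x].

Definition reduced_norm (f : Gamma -> C) : \bar R :=
  ereal_sup [set rep_norm x f | x in [set: X]].

(* A function on X seen as a function on Gamma carried by the unit space. *)
Definition on_units (d : X -> C) (g : Gamma) : C :=
  if `[< is_unit g >] then d (rng g) else 0.

(* For X compact and phi locally injective, V_phi lies in [alg]: its
   coefficient is a polynomial in the finitely valued function
   #phi^{-1}(phi x), which [alg] contains as a function on the unit space. *)
Definition Vphi (g : Gamma) : C :=
  if `[< lag g = 1 /\ src g = phi (rng g) >]
  then ((Num.sqrt (npreimages phi 1 (phi (rng g)))%:R)^-1)%:C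
  else 0.

(* (A, iota) is the completion of [alg] in the reduced norm, which is
   determined up to a unique isometric *-isomorphism. The values of iota off
   [alg] are irrelevant. *)
Record is_reduced_Cstar_algebra (A : unitalCstarAlgebra R)
    (iota : (Gamma -> C) -> A) : Prop := IsReducedCstarAlgebra {
  iotaD : forall f1 f2, alg f1 -> alg f2 ->
    iota (fun g => f1 g + f2 g) = iota f1 + iota f2 ;
  iotaZ : forall (z : C) f, alg f -> iota (fun g => z * f g) = z *: iota f ;
  iotaM : forall f1 f2, alg f1 -> alg f2 ->
    iota (convolution f1 f2) = iota f1 \** iota f2 ;
  iota_adj : forall f, alg f -> iota (invol f) = cstar_adj (iota f) ;
  iota_norm : forall f, alg f ->
    (complex.Re `|iota f|)%:E = reduced_norm f ;
  iota_dense : closure (iota @` alg) = setT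
}.

Definition diagonal_algebra (A : unitalCstarAlgebra R)
    (iota : (Gamma -> C) -> A) : set A :=
  closure (iota @` [set f | alg f /\ forall g, f g != 0 -> is_unit g]).

Definition expi (t : R) : C := cos t +i* sin t.

Record star_automorphism (A : unitalCstarAlgebra R) (s : A -> A) : Prop := {
  autZD : forall (z : C) a b, s (z *: a + b) = z *: s a + s b ;
  autM : forall a b, s (a \** b) = s a \** s b ;
  aut_adj : forall a, s (cstar_adj a) = cstar_adj (s a) ;
  aut_bij : bijective s
}.

(* alpha is alpha^F, for F continuous (so that e^{iFt} belongs to C(X)). *)
Record is_alpha (A : unitalCstarAlgebra R) (iota : (Gamma -> C) -> A)
    (F : X -> R) (alpha : R -> A -> A) : Prop := IsAlpha {
  alpha_aut : forall t, star_automorphism (alpha t) ;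
  alpha0 : forall a, alpha 0 a = a ;
  alphaD : forall s t a, alpha (s + t) a = alpha s (alpha t a) ;
  alpha_continuous : forall a, continuous (fun t : R => alpha t a) ;
  alpha_diag : forall t d, diagonal_algebra iota d -> alpha t d = d ;
  alpha_V : forall t, alpha t (iota Vphi) =
    iota (on_units (fun x => expi (F x * t))) \** iota Vphi
}.

End algebras.

Section KMS.
Variables (R : realType) (A : unitalCstarAlgebra R).
Local Notation C := R[i].

Record is_state (omega : A -> C) : Prop := IsState {
  state_linear : forall (z : C) a b, omega (z *: a + b) = z * omega a + omega b ;
  state_ge0 : forall a, 0 <= omega (cstar_adj a \** a) ;
  state1 : omega cstar_one = 1
}.

(* a is analytic for alpha, and h z = alpha_z(a) for all complex z. *)
Definition analytic_extension (alpha : R -> A -> A) (a : A) (h : C -> A) :=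
  (forall z : C, derivable (h : C^o -> A) z 1) /\
  (forall t : R, h t%:C = alpha t a).

Definition is_KMS_state (alpha : R -> A -> A) (beta : R) (omega : A -> C) :=
  is_state omega /\
  forall x y hx hy,
    analytic_extension alpha x hx -> analytic_extension alpha y hy ->
    omega (x \** y) = omega (y \** hx (0 +i* beta)).

End KMS.

Section growth.
Variables (R : realType) (X : choiceType) (phi : X -> X).

Definition min_value (u : X -> nat) : nat :=
  xget 0%N (range u `&` lbound (range u)).
Definition max_value (u : X -> nat) : nat :=
  xget 0%N (range u `&` ubound (range u)).

Definition min_growth : R :=
  limn (fun n : nat => n%:R^-1 * ln (min_value (npreimages phi n))%:R : R).
Definition max_growth : R :=
  limn (fun n : nat => n%:R^-1 * ln (max_value (npreimages phi n))%:R : R).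

End growth.

Arguments min_growth R {X} phi.
Arguments max_growth R {X} phi.

Notation borel X := (g_sigma_algebraType (@open X)).

(* Main.v *)
(** A KMS state [omega] restricts to the functions on the unit space as an
    eigenstate of the transfer operator [L], where [L d y] is the sum of [d]
    over [phi^-1 y]: one has [omega d = omega (L (e^(-beta F) d))]. Indeed, choose
    a partition of unity [sum_i h_i^2 = 1] with [phi] injective near the support
    of each [h_i], put [w_i (x, 1, phi x) = h_i x], and apply the KMS condition to
    [w_i] and [w_i^* d], since [w_i w_i^* d = h_i^2 d] and
    [w_i^* d e^(-beta F) w_i = L (h_i^2 e^(-beta F) d)].
    Iterating from [d = 1], [omega] takes the value [1] at the function
    [G_n y = sum_(phi^n x = y) e^(-beta S_n F x)], with [S_n F] the Birkhoff sum,
    so that [G_n] is neither everywhere smaller than some [c < 1] nor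
    everywhere larger than some [c > 1]. This yields points [x_n] and [y_n] with
    [beta S_n F x_n <= ln (max #phi^-n) + 1] and
    [beta S_n F y_n >= ln (min #phi^-n) - 1]. The ultralimits of the Birkhoff
    averages along [x_n] and [y_n] are invariant positive functionals on [C(X)],
    sending [beta F] below [M] and above [m] respectively; as [m <= M], a convex
    combination sends [beta F] into [[m, M]], and the Riesz-Markov theorem
    represents it by an invariant measure. *)

Require Import Defs.
From HB Require Import structures.
From mathcomp Require Import all_boot all_order all_algebra.
From mathcomp Require Import complex finmap.
From mathcomp Require Import all_classical all_reals all_analysis.
From mathcomp Require Import ring lra.

Set Implicit Arguments.
Unset Strict Implicit.
Unset Printing Implicit Defensive.

Import Order.TTheory GRing.Theory Num.Theory.
Import numFieldNormedType.Exports.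

Local Open Scope classical_set_scope.
Local Open Scope ring_scope.
Local Open Scope complex_scope.

(** * C*-algebras and states *)

(** The obstacle is that [phi] need not be open: the number of preimages may be discontinuous, and
    the transfer operator need not preserve C(X). The state is therefore followed on the class
    [diag] of functions that [alg] contains on the unit space. Since [iota] is controlled on [alg]
    only, each function has to be shown to belong there. Products of functions carried by the graph
    of [phi] with their involutions provide this: one order of the factors gives the transfer
    operator, the other one, once localised, gives composition with [phi]. As [is_alpha] prescribes
    the action on the diagonal and on [Vphi], each w_i has to be written as a diagonal element times
    [Vphi], and so the square root of the number of preimages must lie in [diag]. Positivity of
    [omega] on [diag] rests on two facts: the reduced norm is at most the supremum norm, and 1 - x
    is the square of a self-adjoint element when x is self-adjoint of norm at most 1. The constants
    1 beside the logarithms are slack that puts G_n uniformly below exp (-1) or above exp 1;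
    division by n removes them. *)

Lemma conj_real (R : realType) (r : R) : (r%:C : R[i])^* = r%:C.
Proof. exact: conjc_real. Qed.

Lemma realCM (R : realType) (a b : R) : (a * b)%:C = a%:C * b%:C :> R[i].
Proof. exact: rmorphM. Qed.

Section cstar_norm.
Variables (R : realType) (A : unitalCstarAlgebra R).
Implicit Types (a b x y : A) (z : R[i]).

(* The norm of [A] takes its values in [R[i]]; its real part is the one that
   [lra] and the order of [R] can handle. *)
Definition rnorm (V : normedModType R[i]) (a : V) : R := complex.Re `|a|.

Lemma rnormE (V : normedModType R[i]) (a : V) : `|a| = (rnorm a)%:C.
Proof. by rewrite /rnorm RRe_real// normr_real. Qed.

Lemma rnorm_ge0 (V : normedModType R[i]) (a : V) : 0 <= rnorm a.
Proof. by rewrite -ler0c -rnormE. Qed.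

Lemma rnormD (V : normedModType R[i]) (a b : V) :
  rnorm (a + b) <= rnorm a + rnorm b.
Proof. by rewrite -lecR rmorphD/= -!rnormE ler_normD. Qed.

Lemma rnormN (V : normedModType R[i]) (a : V) : rnorm (- a) = rnorm a.
Proof. by rewrite /rnorm normrN. Qed.

Lemma rnorm0 (V : normedModType R[i]) : rnorm (0 : V) = 0.
Proof. by rewrite /rnorm normr0. Qed.

Lemma rnorm_eq0 (V : normedModType R[i]) (a : V) : rnorm a = 0 -> a = 0.
Proof. by move=> a0; apply/normr0_eq0; rewrite rnormE a0. Qed.

Lemma rnormZ (V : normedModType R[i]) z (a : V) :
  rnorm (z *: a) = complex.Re `|z| * rnorm a.
Proof.
apply: (@complexI R).
by rewrite rmorphM/= -!rnormE normrZ.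
Qed.

Lemma rnormM a b : rnorm (a \** b) <= rnorm a * rnorm b.
Proof. by rewrite -lecR rmorphM/= -!rnormE cstar_normM. Qed.

(** [cstar_identity] and [rnormM] give |b|^2 <= |adj b| |b|, so |b| <= |adj b|; the same for the
    adjoint of [b] is the converse. *)
Lemma rnorm_adj a : rnorm (cstar_adj a) = rnorm a.
Proof.
have le b : rnorm b <= rnorm (cstar_adj b).
  have [->|b0] := eqVneq (rnorm b) 0; first exact: rnorm_ge0.
  have b_gt0 : 0 < rnorm b by rewrite lt_neqAle eq_sym b0 rnorm_ge0.
  rewrite -(ler_pM2r b_gt0); apply: le_trans (rnormM _ _).
  rewrite -lecR -rnormE cstar_identity rnormE -rmorphXn/=.
  by rewrite lecR expr2.
by apply/eqP; rewrite eq_le le -{2}(cstar_adjK a) le.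
Qed.

Lemma rnorm_cvgP (V : normedModType R[i]) (T : Type) (F : set_system T)
  {FF : Filter F} (f : T -> V) (l : V) :
  f t @[t --> F] --> l <->
  forall e : R, 0 < e -> \forall t \near F, rnorm (l - f t) < e.
Proof.
split=> [/cvgrPdist_lt fl e e0|fl].
  have := fl e%:C; rewrite ltcR => /(_ e0).
  by apply: filterS => t; rewrite rnormE ltcR.
apply/cvgrPdist_lt => e e0.
have eE : e = (complex.Re e)%:C by rewrite RRe_real// gtr0_real.
move: e0; rewrite eE ltcR => e0; apply: filterS (fl _ e0) => t.
by rewrite rnormE ltcR.
Qed.

Lemma rnorm_small_eq0 a : (forall e : R, 0 < e -> rnorm a <= e) -> a = 0.
Proof.
move=> h; apply: rnorm_eq0; apply/eqP; rewrite eq_le rnorm_ge0 andbT.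
by apply/ler_addgt0Pr => e e0; rewrite add0r h.
Qed.

Lemma rnormB (V : normedModType R[i]) (a b : V) : rnorm (a - b) = rnorm (b - a).
Proof. by rewrite -rnormN opprB. Qed.

Lemma cstar_mulNl a b : (- a) \** b = - (a \** b).
Proof. by rewrite -[- a]scaleN1r -cstar_scaleAl scaleN1r. Qed.

Lemma cstar_mulNr a b : a \** (- b) = - (a \** b).
Proof. by rewrite -[- b]scaleN1r -cstar_scaleAr scaleN1r. Qed.

Lemma cstar_mulBl a b c : (a - b) \** c = a \** c - b \** c.
Proof. by rewrite cstar_mulDl cstar_mulNl. Qed.

Lemma cstar_mulBr a b c : a \** (b - c) = a \** b - a \** c.
Proof. by rewrite cstar_mulDr cstar_mulNr. Qed.

Lemma cstar_sqrB a b :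
  a \** a - b \** b = a \** (a - b) + (a - b) \** b.
Proof. by rewrite cstar_mulBr cstar_mulBl addrA subrK. Qed.

Lemma cstar_adjB a b : cstar_adj (a - b) = cstar_adj a - cstar_adj b.
Proof.
by rewrite cstar_adjD -scaleN1r cstar_adjZ rmorphN1 scaleN1r.
Qed.

Lemma cstar_adj1 : cstar_adj (cstar_one : A) = cstar_one.
Proof.
rewrite -[LHS]cstar_mulr1 -[X in _ \** X](cstar_adjK cstar_one).
by rewrite -cstar_adjM cstar_mulr1 cstar_adjK.
Qed.

End cstar_norm.

Section one_minus_square.
Variables (R : realType) (A : unitalCstarAlgebra R) (x : A).
Hypotheses (xh : cstar_adj x = x) (x1 : rnorm x <= 1).

Let half : R[i] := (2^-1 : R)%:C.

Let half_norm : complex.Re `|half| = 2^-1.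
Proof. by rewrite /half normc_def /= expr0n/= addr0 sqrtr_sqr ger0_norm. Qed.

Let y (k : nat) : A := iter k (fun b => half *: (x + b \** b)) 0.
(** The recursion of [y] run in R with 1 in place of [x]. It is increasing and bounded by 1, and its
    increments will dominate those of [y], which makes [y] Cauchy. *)
Let t (k : nat) : R := iter k (fun s => 2^-1 * (1 + s ^+ 2)) 0.

Let tS k : t k.+1 = 2^-1 * (1 + t k ^+ 2). Proof. by []. Qed.

Let t01 k : 0 <= t k <= 1.
Proof.
elim: k => [|k /andP[t0 t1]]; first by rewrite lexx ler01.
by rewrite tS; apply/andP; split; nra.
Qed.

Let t_incr k : t k <= t k.+1.
Proof. by rewrite tS; have := sqr_ge0 (1 - t k); nra. Qed.

Let ySB k : y k.+2 - y k.+1 =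
  half *: (y k.+1 \** (y k.+1 - y k) + (y k.+1 - y k) \** y k).
Proof.
rewrite -cstar_sqrB {1}/y iterS -/(y _) [y k.+1 in X in _ - X]/y iterS -/(y _).
by rewrite -scalerBr opprD addrACA subrr add0r.
Qed.

(** By [ySB], each increment of [y] is half of b (b - a) + (b - a) a, where a and b are the two
    previous iterates. Its norm is at most half of (t_(k+1) + t_k) (t_(k+1) - t_k), which is the
    next increment of [t]. *)
Let yP k : rnorm (y k) <= t k /\ rnorm (y k.+1 - y k) <= t k.+1 - t k.
Proof.
elim: k => [|k [IH1 IH2]].
  split; first by rewrite /y /t/= rnorm0.
  rewrite /y /t /= subr0 rnormZ half_norm.
  have -> : (0 : A) \** 0 = 0 by rewrite -(scale0r 0) -cstar_scaleAl !scale0r.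
  by rewrite addr0 expr0n/= addr0 subr0 ler_pM2l ?invr_gt0.
have IH1' : rnorm (y k.+1) <= t k.+1.
  rewrite -[y k.+1](subrK (y k)); apply: le_trans (rnormD _ _) _; lra.
split=> //; rewrite ySB rnormZ half_norm.
have := rnormD (y k.+1 \** (y k.+1 - y k)) ((y k.+1 - y k) \** y k).
have := rnormM (y k.+1) (y k.+1 - y k).
have := rnormM (y k.+1 - y k) (y k).
have -> : t k.+2 - t k.+1 = 2^-1 * (t k.+1 ^+ 2 - t k ^+ 2).
  by rewrite !tS; ring.
have := rnorm_ge0 (y k.+1 - y k); have := rnorm_ge0 (y k).
have := rnorm_ge0 (y k.+1); case/andP: (t01 k); have := t_incr k; nra.
Qed.

Let y_dist m n : (n <= m)%N -> rnorm (y m - y n) <= t m - t n.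
Proof.
elim: m => [|m IH]; first by rewrite leqn0 => /eqP ->; rewrite !subrr rnorm0.
rewrite leq_eqVlt => /predU1P[->|]; first by rewrite !subrr rnorm0.
rewrite ltnS => /IH nm; rewrite -(subrKA (y m)).
by apply: le_trans (rnormD _ _) _; have [_] := yP m; lra.
Qed.

Let y_adj k : cstar_adj (y k) = y k.
Proof.
elim: k => [|k IH].
  by rewrite /y /=; apply: (addrI (cstar_adj 0)); rewrite -cstar_adjD !addr0.
rewrite /y iterS -/(y k) cstar_adjZ cstar_adjD cstar_adjM IH xh.
by rewrite /half; congr (_ *: _); exact: conj_real.
Qed.

Let t_cvg : exists l : R, t n @[n --> \oo] --> l.
Proof.
apply/cvg_ex; apply: nondecreasing_is_cvgn; first exact/nondecreasing_seqP.
by exists 1 => _ [n _ <-]; case/andP: (t01 n).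
Qed.

Let y_cvg : exists l : A, y n @[n --> \oo] --> l.
Proof.
apply/cvg_ex; apply: cauchy_cvg; apply/cauchyP => e e0.
have eE : e = (complex.Re e)%:C by rewrite RRe_real// gtr0_real.
move: e0; rewrite eE ltcR => e0.
have [l /cvgrPdist_lt tl] := t_cvg.
have [N _ NP] := tl _ (divr_gt0 e0 (ltr0n R 2)).
exists (y N), N => // n /= Nn; rewrite -ball_normE /= distrC rnormE ltcR.
apply: le_lt_trans (y_dist Nn) _.
have := NP _ (leqnn N); have := NP _ Nn.
by rewrite !ltr_norml; lra.
Qed.

(* The iteration [y := (x + y^2) / 2] converges to [1 - sqrt (1 - x)]. *)
Lemma one_minus_eq_square :
  exists2 b : A, cstar_adj b = b & cstar_one - x = b \** b.
Proof.
have [l /rnorm_cvgP yl] := y_cvg.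
have lh : cstar_adj l = l.
  apply/eqP; rewrite -subr_eq0; apply/eqP/rnorm_small_eq0 => e e0.
  have [N _ /(_ N (leqnn N)) h] := yl _ (divr_gt0 e0 (ltr0n R 2)).
  rewrite -(subrKA (y N)) -{1}(y_adj N) -cstar_adjB.
  apply: le_trans (rnormD _ _) _.
  by rewrite rnorm_adj (rnormB (y N)) [leRHS]splitr lerD// ltW.
have l1 : rnorm l <= 1.
  apply/ler_addgt0Pr => e e0; have [N _ /(_ N (leqnn N)) h] := yl _ e0.
  rewrite -(subrK (y N) l); apply: le_trans (rnormD _ _) _.
  by have [+ _] := yP N; case/andP: (t01 N); lra.
(* The error consists of two copies of l - y_(N+1) and of a term of norm at most (|l| + |y_N|) |l -
   y_N| <= 2 |l - y_N|; hence the choice of e / 4. *)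
have lE : l + l = x + l \** l.
  apply/eqP; rewrite -subr_eq0; apply/eqP/rnorm_small_eq0 => e e0.
  have [N _ NP] := yl _ (divr_gt0 e0 (ltr0n R 4)).
  have h0 := NP _ (leqnn N); have h1 := NP _ (leqnSn N).
  have yS : y N.+1 + y N.+1 = x + y N \** y N.
    rewrite /y iterS -/(y N) -scalerDl /half -rmorphD/=.
    have -> : 2^-1 + 2^-1 = 1 :> R by lra.
    by rewrite scale1r.
  have -> : l + l - (x + l \** l) = (l - y N.+1) + (l - y N.+1) -
      (l \** (l - y N) + (l - y N) \** y N).
    rewrite -cstar_sqrB addrACA -opprD yS -[RHS]addrA -opprD.
    by congr (_ - _); rewrite addrA addrAC addrK.
  have [yN _] := yP N.
  have := rnormD (l - y N.+1 + (l - y N.+1))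
    (- (l \** (l - y N) + (l - y N) \** y N)).
  rewrite rnormN.
  have := rnormD (l - y N.+1) (l - y N.+1).
  have := rnormD (l \** (l - y N)) ((l - y N) \** y N).
  have := rnormM l (l - y N); have := rnormM (l - y N) (y N).
  have := rnorm_ge0 l; have := rnorm_ge0 (y N); have := rnorm_ge0 (l - y N).
  case/andP: (t01 N); nra.
(* By [lE], (1 - l)^2 = 1 - 2 l + l^2 = 1 - x. *)
exists (cstar_one - l); first by rewrite cstar_adjB cstar_adj1 lh.
rewrite cstar_mulBr cstar_mulr1 cstar_mulBl cstar_mul1.
have -> : l \** l = l + l - x by rewrite lE addrAC subrr add0r.
have -> : l - (l + l - x) = x - l.
  by rewrite opprB opprD addrC -addrA subrK.
by rewrite opprB addrA subrK.
Qed.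

End one_minus_square.

Section states.
Variables (R : realType) (A : unitalCstarAlgebra R) (omega : A -> R[i]).
Hypothesis om : is_state omega.

(** [state_ge0] speaks of products of an element with its adjoint; this is the form in which
    positivity of [omega] is used from here on. *)
Lemma state_ge0_one_minus x :
  cstar_adj x = x -> rnorm x <= 1 -> 0 <= omega (cstar_one - x).
Proof.
move=> xh x1; have [b bh ->] := one_minus_eq_square xh x1.
by rewrite -{1}bh state_ge0.
Qed.

Lemma stateD a b : omega (a + b) = omega a + omega b.
Proof. by rewrite -[a]scale1r state_linear// mul1r scale1r. Qed.

Lemma state0 : omega 0 = 0.
Proof. by apply: (addrI (omega 0)); rewrite -stateD !addr0. Qed.

Lemma stateZ z a : omega (z *: a) = z * omega a.
Proof. by rewrite -[z *: a]addr0 state_linear// state0 addr0. Qed.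

End states.

(** * Compact metric spaces and locally injective maps *)

Section metric.
Variables (R : realType).

Lemma mdist_near (T : Type) (F : set_system T) {FF : Filter F}
    (X : metricType R) (f : T -> X) (l : X) :
  f t @[t --> F] --> l ->
  forall e : R, 0 < e -> F [set t | mdist l (f t) < e].
Proof.
move=> fl e e0; have : F (f @^-1` ball l e) := fl _ (nbhsx_ballx l e e0).
by rewrite ballEmdist.
Qed.

Lemma mdist_continuous (T : topologicalType) (X : metricType R) (f g : T -> X) :
  continuous f -> continuous g -> continuous (fun t => mdist (f t) (g t)).
Proof.
move=> cf cg t0; apply/cvgrPdist_lt => e e0.
have e2 : 0 < e / 2 by rewrite divr_gt0.
have hf : nbhs t0 [set t | mdist (f t0) (f t) < e / 2].
  exact: mdist_near (cf t0) _ e2.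
have hg : nbhs t0 [set t | mdist (g t0) (g t) < e / 2].
  exact: mdist_near (cg t0) _ e2.
apply: filterS2 hf hg => t /= h1 h2.
have := metric_triangle (f t0) (f t) (g t0).
have := metric_triangle (f t) (g t) (g t0).
have := metric_triangle (f t) (f t0) (g t).
have := metric_triangle (f t0) (g t0) (g t).
rewrite (metric_sym (f t) (f t0)) (metric_sym (g t) (g t0)).
move: h1 h2; rewrite ltr_norml => h1 h2 h3 h4 h5 h6; apply/andP; split; lra.
Qed.

Lemma continuous_sum (T : topologicalType) (I : Type) (r : seq I) (f : I ->
  T -> R) :
  (forall i, continuous (f i)) -> continuous (fun t => \sum_(i <- r) f i t).
Proof.
move=> cf t; elim: r => [|i r IH].
  under eq_fun do rewrite big_nil.
  exact: cvg_cst.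
under eq_fun do rewrite big_cons.
by apply: cvgD => //; exact: cf.
Qed.

Lemma continuous_iter (T : topologicalType) (f : T -> T) n :
  continuous f -> continuous (iter n f).
Proof.
move=> cf; elim: n => [|n IH] x; first exact: cvg_id.
by apply: continuous_comp; [exact: IH|exact: cf].
Qed.

Variables (X : pointedMetricType R) (phi : X -> X).
Hypotheses (cX : compact [set: X]).

Lemma compact_continuous_bounded (f : X -> R) : continuous f ->
  exists2 B : R, 0 < B & forall x, `|f x| <= B.
Proof.
move=> cf.
have : bounded_set (f @` [set: X]).
  apply: compact_bounded; apply: continuous_compact => //.
  exact: continuous_subspaceT.
move=> [B [_ hB]]; exists (`|B| + 1); first by rewrite ltr_wpDl.
by move=> x; apply: hB; [rewrite (le_lt_trans (ler_norm _))// ltrDl|exists x].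
Qed.

Lemma finite_ball_cover (e : X -> R) : (forall x, 0 < e x) ->
  exists s : seq X, forall x, exists2 c, c \in s & mdist c x < e c.
Proof.
move=> e0; have := cX;
  rewrite compact_cover => /(_ X setT (fun x => (ball x (e x))°)).
case.
- by move=> x _; exact: open_interior.
- by move=> x _; exists x => //; apply: nbhsx_ballx.
move=> D _ DP; exists (enum_fset D) => x.
have [c cD /interior_subset] := DP x I.
by rewrite ballEmdist; exists c.
Qed.

Hypothesis inj : locally_injective phi.

(** A Lebesgue number argument: if x lies in the ball around a centre c of half the radius of
    injectivity, a point y close enough to x still lies in the full ball around c. *)
Lemma locally_injective_uniform :
  exists2 e : R, 0 < e &
    forall x y, mdist x y < e -> phi x = phi y -> x = y.
Proof.
have /choice[r rP] : forall x, exists r : R, 0 < r /\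
    forall y z, mdist x y < r -> mdist x z < r -> phi y = phi z -> y = z.
  move=> x; have [B [Bo Bb] Binj] := inj.
  have [U [BU Ux _]] := Bb x setT filterT.
  have /nbhs_ballP[r r0 rU] : nbhs x U by apply: open_nbhs_nbhs; split=> //;
    exact: Bo.
  exists r; split=> // y z; rewrite ballEmdist in rU => xy xz.
  by apply: (Binj _ BU); rewrite inE; exact: rU.
have [s sP] := @finite_ball_cover (fun x => r x / 2)
  (fun x => divr_gt0 (proj1 (rP x)) (ltr0n R 2)).
exists (\big[Order.min/1]_(c <- s) (r c / 2)).
  elim: (s) => [|c s' IH]; first by rewrite big_nil.
  by rewrite big_cons lt_min IH divr_gt0// (proj1 (rP c)).
move=> x y xy; have [c cs cx] := sP x.
have [rc0] := rP c; apply.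
- by apply: lt_trans cx _; rewrite ltr_pdivrMr// ltr_pMr// ltr1n.
- apply: le_lt_trans (metric_triangle _ x _) _.
  have : mdist x y < r c / 2.
    apply: lt_le_trans xy _; elim: (s) cs => // a s' IH.
    rewrite in_cons big_cons ge_min => /predU1P[->|/IH ->].
      by rewrite lexx.
    by rewrite orbT.
  by move=> xy'; rewrite [ltRHS]splitr ltrD.
Qed.

(** Two points of a fibre that are e / 2-close to the same centre coincide, so sending a point to a
    centre near it is injective on every fibre. The number of centres is a bound that is uniform in
    y. *)
Lemma finite_preimage : exists K : nat, forall y,
  finite_set [set x | phi x = y] /\
  (#|` fset_set [set x | phi x = y]| <= K)%fset%N.
Proof.
have [e e0 eP] := locally_injective_uniform.
have [s sP] := @finite_ball_cover (fun=> e / 2) (fun=> divr_gt0 e0 (ltr0n R 2)).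
have /choice[c cP] : forall x, exists c, c \in s /\ mdist c x < e / 2.
  by move=> x; have [c ? ?] := sP x; exists c.
exists (size s) => y.
have cinj : {in [set x | phi x = y] &, injective c}.
  move=> x x'; rewrite !inE/= => <- xx' cxx'; apply: eP => //.
  have [_ h1] := cP x; have [_] := cP x'; rewrite -cxx' => h2.
  apply: le_lt_trans (metric_triangle _ (c x) _) _.
  by rewrite [ltRHS]splitr ltrD// metric_sym.
(* [g] inverts [c] on the fibre, which exhibits the fibre as part of the image of a finite set. *)
pose g a := xget point [set x | phi x = y /\ c x = a].
have sub : [set x | phi x = y] `<=` g @` [set` s].
  move=> x xy; exists (c x); first by have [] := cP x.
  have [gy cg] : [set z | phi z = y /\ c z = c x] (g (c x)) :=
    xgetPex point (ex_intro _ x (conj xy erefl)).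
  by apply: cinj; rewrite ?inE.
have fin : finite_set [set x | phi x = y].
  exact: sub_finite_set sub (finite_image _ (finite_seq s)).
split => //; apply: (@leq_trans #|` [fset g a | a in s]|%fset).
  apply: fsubset_leq_card; apply/fsubsetP => x; rewrite in_fset_set// inE.
  by move=> /sub[a /= a_s <-]; apply/imfsetP; exists a.
apply: leq_trans (leq_imfset_card _ _ _) _; apply: uniq_leq_size => [|a];
  first exact: enum_finmem_uniq.
by rewrite enum_finmemE.
Qed.

Lemma finite_preimage1 y : finite_set [set x | phi x = y].
Proof. by have [K hK] := finite_preimage; have [] := hK y. Qed.

(** Square roots of normalised tents of radius e / 2 around the centres of a finite cover; two
    points under one tent are e-close through its centre. *)
Lemma partition_of_unity (e : R) : 0 < e ->
  exists (m : nat) (h : 'I_m -> X -> R),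
  [/\ forall i, continuous (h i),
      forall i x y, h i x != 0 -> h i y != 0 -> mdist x y < e &
      forall x, \sum_(i < m) h i x ^+ 2 = 1].
Proof.
move=> e0; have [s sP] :=
  @finite_ball_cover (fun=> e / 2) (fun=> divr_gt0 e0 (ltr0n R 2)).
pose g (i : 'I_(size s)) x :=
  Order.max 0 (e / 2 - mdist (tnth (in_tuple s) i) x).
have gc i : continuous (g i).
  move=> x; apply: (@continuous_max R X (cst 0) (fun z =>
    e / 2 - mdist (tnth (in_tuple s) i) z)).
    exact: cvg_cst.
  apply: cvgB; first exact: cvg_cst.
  apply: (@mdist_continuous X X (cst _) idfun) => ?; first exact: cvg_cst.
  exact: cvg_id.
have g0 i x : 0 <= g i x by rewrite le_max lexx.
pose G x := \sum_i g i x.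
have G0 x : 0 < G x.
  have [c cs cx] := sP x.
  have ci : (index c s < size s)%N by rewrite index_mem.
  rewrite /G (bigD1 (Ordinal ci))//= ltr_pwDl ?sumr_ge0//.
  by rewrite lt_max subr_gt0 (tnth_nth c) /= nth_index// cx orbT.
have Gc : continuous G.
  by apply: continuous_sum => i; exact: gc.
exists (size s), (fun i x => Num.sqrt (g i x / G x)); split.
- move=> i x; apply: (@continuous_comp _ _ _ (fun x => g i x / G x) Num.sqrt).
    by apply: cvgM; [exact: gc|apply: cvgV; [exact/lt0r_neq0/G0|exact: Gc]].
  exact: sqrt_continuous.
- move=> i x y.
  have pos z : Num.sqrt (g i z / G z) != 0 ->
    mdist (tnth (in_tuple s) i) z < e / 2.
    rewrite sqrtr_eq0 -ltNge pmulr_lgt0 ?invr_gt0// lt_max ltxx/=.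
    by rewrite subr_gt0.
  move=> /pos hx /pos hy.
  apply: le_lt_trans (metric_triangle _ (tnth (in_tuple s) i) _) _.
  by rewrite [ltRHS]splitr ltrD// metric_sym.
- move=> x; transitivity (\sum_i g i x / G x); last first.
    by rewrite -mulr_suml mulfV//; exact/lt0r_neq0/G0.
  by apply: eq_bigr => i _; rewrite sqr_sqrtr// divr_ge0// ltW// G0.
Qed.

End metric.

Section fibers.
Variables (R : pzRingType) (X : choiceType) (phi : X -> X).
Hypothesis fin : forall y, finite_set [set x | phi x = y].

Lemma finite_fiber n y : finite_set [set x | iter n phi x = y].
Proof.
elim: n y => [|n IH] y.
  by rewrite (_ : [set _ | _] = [set y])//; exact: finite_set1.
rewrite (_ : [set _ | _] =
    \bigcup_(x in [set x | phi x = y]) [set z | iter n phi z = x]).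
  by apply: bigcup_finite => // x _; exact: IH.
by apply/seteqP; split => [z /= zy|z [x /= xy zx]];
  [exists (iter n phi z)|rewrite zx].
Qed.

Lemma fiber_sum (u : X -> R) n k y :
  \sum_(z \in [set z | iter (n + k) phi z = y]) u z =
  \sum_(x \in [set x | iter n phi x = y])
     \sum_(z \in [set z | iter k phi z = x]) u z.
Proof.
rewrite !fsbig_finite; [|exact: finite_fiber|exact: finite_fiber] => /=.
pose S := fset_set [set z | iter (n + k) phi z = y].
pose T := fset_set [set x | iter n phi x = y].
rewrite -/S -/T.
transitivity (\sum_(z <- S) \sum_(x <- T | x == iter k phi z) u z).
  apply: eq_big_seq => z; rewrite in_fset_set; last exact: finite_fiber.
  rewrite inE /= => zy.
  have zT : iter k phi z \in T.
    by rewrite in_fset_set ?inE /= -?iterD//; exact: finite_fiber.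
  by rewrite -big_filter filter_pred1_uniq ?fset_uniq// big_seq1.
rewrite (exchange_big_dep xpredT) //=; apply: eq_big_seq => x.
rewrite in_fset_set; last exact: finite_fiber.
rewrite inE /= => xy.
rewrite fsbig_finite /=; last exact: finite_fiber.
rewrite big_fset_condE.
suff -> : [fset z in S | x == iter k phi z]%fset =
  fset_set [set z | iter k phi z = x] by [].
apply/fsetP => z.
rewrite !inE !in_fset_set; [|exact: finite_fiber|exact: finite_fiber].
apply/andP/idP => [[_ /eqP zx]|]; rewrite inE /=; first by rewrite zx.
by move=> zx; split; [rewrite inE /= iterD zx|rewrite zx].
Qed.

Lemma npreimages_sum n y :
  (npreimages phi n y)%:R = \sum_(x \in [set x | iter n phi x = y]) (1 : R).
Proof.
rewrite fsbig_finite/=; last exact: finite_fiber.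
by rewrite big_const_seq iter_addr addr0 count_predT.
Qed.

End fibers.

(** * The groupoid and its convolution algebra *)

Section graphs.
Variables (R : realType) (X : topologicalType) (phi : X -> X).
Local Notation Gamma := (gpd phi).
Local Notation C := R[i].

Lemma gpd_eq (g1 g2 : Gamma) :
  rng g1 = rng g2 -> lag g1 = lag g2 -> src g1 = src g2 -> g1 = g2.
Proof.
case: g1 g2 => -[[x k] y] P1 [[[x' k'] y'] P2] xx kk yy; apply: val_inj => /=.
by move: xx kk yy; rewrite /rng /lag /src /= => -> -> ->.
Qed.

Lemma in_gpd_iter (k : nat) (x : X) :
  `[< @in_gpd X phi x k%:Z (iter k phi x) >].
Proof. by apply/asboolP; exists k, 0%N; split => //; rewrite subr0. Qed.

Definition graph (k : nat) (x : X) : Gamma :=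
  @Gpd _ phi (x, k%:Z, iter k phi x) (in_gpd_iter k x).

Definition is_graph (k : nat) (g : Gamma) : Prop :=
  lag g = k%:Z /\ src g = iter k phi (rng g).

Lemma is_graphP k g : is_graph k g <-> g = graph k (rng g).
Proof. by split=> [[? ?]|->//]; apply: gpd_eq. Qed.

Lemma is_graph_stratum k : is_graph k = @stratum X phi k%:Z 0.
Proof.
apply/seteqP; split => g [gk gg]; split=> //.
  by move=> i _; rewrite gg -iterD addnC.
by have := gg 0%N (leqnn _); rewrite addr0.
Qed.

(** Two cases matter: k = 0 gives [on_units], and k = 1 gives [Vphi] and the elements w_i. *)
Definition graph_fun (k : nat) (f : X -> C) (g : Gamma) : C :=
  if `[< is_graph k g >] then f (rng g) else 0.

Lemma stratum_lag_neq (k : nat) (l : int) n (g : Gamma) :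
  l != k%:Z -> @stratum X phi l n g -> ~ is_graph k g.
Proof. by move=> lk [gl _] [gk _]; move: lk; rewrite -gl gk eqxx. Qed.

End graphs.

Section graph_topology.
Variables (R : realType) (X : pointedMetricType R) (phi : X -> X).
Hypotheses (cX : compact [set: X]) (cphi : continuous phi)
  (inj : locally_injective phi).
Local Notation Gamma := (gpd phi).
Local Notation C := R[i].
Local Notation graph := (@graph X phi).
Local Notation is_graph := (@is_graph X phi).
Local Notation graph_fun := (@graph_fun R X phi).

(** The image lies in the single stratum (k, 0), so only the trace of an open set on that stratum
    counts, and there the topology is the relative one. *)
Lemma graph_continuous k : continuous (graph k).
Proof.
apply/continuousP => U oU; have [|W oW UW] := oU k%:Z 0%N;
  first by rewrite add0r.
pose h x : X * discrete_topology int * X := (x, k%:Z, iter k phi x).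
have -> : graph k @^-1` U = h @^-1` W.
  have g0 x : @stratum X phi k%:Z 0 (graph k x) by rewrite -is_graph_stratum.
  apply/seteqP; split => x /= Ux.
    have : (U `&` @stratum X phi k%:Z 0) (graph k x) by [].
    by rewrite UW => -[].
  have : (gpd_val (phi:=phi) @^-1` W `&` @stratum X phi k%:Z 0) (graph k x) by
    [].
  by rewrite -UW => -[].
apply: open_comp => // x _.
have cx : {for x, continuous (fun x : X => (x, k%:Z : discrete_topology int))}.
  by apply: (@cvg_pair _ _ _ (nbhs x) (nbhs x) (nbhs (k%:Z : discrete_topology
    int)));
    [exact: cvg_id|exact: cvg_cst].
have cy := @continuous_iter X phi k cphi x.
exact: (@cvg_pair _ _ _ (nbhs x) _ _ _ _ _ _ _ cx cy).
Qed.

(* If the orbits of [iter k phi x] and [y] merge after [n] steps and stay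
   [e]-close until then, [phi] being injective at scale [e], they coincide from
   the start. *)
Lemma graph_neighborhood (k n : nat) :
  exists2 O : set (X * discrete_topology int * X),
  open O & @stratum X phi k%:Z n `&` @gpd_val X phi @^-1` O = is_graph k.
Proof.
have [e e0 eP] := locally_injective_uniform cX inj.
pose D (v : X * discrete_topology int * X) : R :=
  \sum_(j < n) mdist (iter j phi (iter k phi v.1.1)) (iter j phi v.2).
exists (D @^-1` [set r | r < e]).
  apply: open_comp; last exact: open_lt.
  move=> v _; apply: continuous_sum => j; apply: (@mdist_continuous R _ X) => w.
    apply: (@continuous_comp _ _ _ (fun w : X * discrete_topology int * X =>
      w.1.1)
      (fun x => iter j phi (iter k phi x))).
      by apply: continuous_comp; exact: cvg_fst.
    by apply: continuous_comp; exact: continuous_iter.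
  by apply: continuous_comp; [exact: cvg_snd|exact: continuous_iter].
apply/seteqP; split => g /=.
  move=> [[gk gn] gO]; split=> //; apply/esym.
  have {}gn i : (n <= i)%N ->
    iter i phi (iter k phi (rng g)) = iter i phi (src g).
    by move=> /gn; rewrite -iterD addnC.
  have desc i : (i <= n)%N ->
    iter (n - i) phi (iter k phi (rng g)) = iter (n - i) phi (src g).
    elim: i => [|i IH] lin; first by rewrite subn0 gn.
    apply: eP.
      have lt : (n - i.+1 < n)%N by rewrite ltn_subrL (leq_trans _ lin).
      apply: le_lt_trans gO; rewrite /D (bigD1 (Ordinal lt))//= lerDl.
      by apply: sumr_ge0 => *; exact: mdist_ge0.
    by rewrite -!iterS -subSn// subSS; exact: IH (ltnW lin).
  by have := desc n (leqnn n); rewrite subnn.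
move=> gk; split.
  move: gk; rewrite is_graph_stratum => -[gk gi]; split=> // i _; exact: gi.
rewrite /D big1// => j _; have [_] := gk; rewrite /rng /src => ->.
by rewrite mdistxx.
Qed.

(** Inside each stratum of lag [k] the graph is open by [graph_neighborhood], and its complement is
    open as the locus where phi^k x and y are at positive distance. Hence extension by 0 keeps
    continuity. On strata of another lag the function vanishes. *)
Lemma graph_fun_continuous k (f : X -> C) :
  continuous (f : X -> C^o) -> continuous (graph_fun k f : Gamma -> C^o).
Proof.
move=> cf; apply/continuousP => U oU.
suff : @gpd_open X phi (graph_fun k f @^-1` U) by [].
move=> l n ln.
have [lk|lk] := eqVneq l k%:Z; last first.
  have [U0|U0] := pselect (U 0).
    exists setT; first exact: openT.
    rewrite preimage_setT setTI; apply: setIidr => g gl /=.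
    by rewrite /graph_fun asboolF//; exact: stratum_lag_neq lk gl.
  exists set0; first exact: open0.
  rewrite preimage_set0 set0I -subset0 => g [] /=.
  rewrite /graph_fun => + gl; rewrite asboolF//; exact: stratum_lag_neq lk gl.
rewrite {l}lk in ln *; have [V oV VE] := graph_neighborhood k n.
have cD : continuous (fun v : X * discrete_topology int * X =>
    mdist (iter k phi v.1.1) v.2).
  apply: (@mdist_continuous R _ X).
    move=> v; apply: (@continuous_comp _ _ _ (fun v => v.1.1)).
      by apply: continuous_comp; exact: cvg_fst.
    exact: continuous_iter.
  by move=> v; exact: cvg_snd.
(* The arrows off the graph, where the value is 0: they belong to the preimage exactly when [U]
   contains 0. *)
pose N := [set v : X * discrete_topology int * X | U 0 /\ 0 < mdist (iter k phi
  v.1.1) v.2].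
exists ((V `&` [set v | U (f v.1.1)]) `|` N).
  apply: openU; first apply: openI => //.
    have cf1 : continuous (fun v : X * discrete_topology int * X =>
      f v.1.1 : C^o).
      move=> v; apply: (@continuous_comp (X * discrete_topology int * X)%type X
        C^o
        (fun v => v.1.1) f v); last exact: cf.
      by apply: continuous_comp; exact: cvg_fst.
    by move/continuousP: cf1; apply.
  rewrite /N; have [U0|U0] := pselect (U 0); last first.
    by rewrite (_ : mkset _ = set0) ?open0// -subset0 => v [].
  rewrite (_ : mkset _ = (fun v : X * discrete_topology int * X =>
    mdist (iter k phi v.1.1) v.2) @^-1` [set r | 0 < r]).
    by apply: open_comp; [move=> ? _; exact: cD|exact: open_gt].
  by apply/seteqP; split => v //= [].
apply/seteqP; split => g [] /= gU gk; split => //.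
- move: gU; rewrite /graph_fun; case: asboolP => [gg fU|ng U0].
    left; split=> //; move: gg; rewrite -VE => -[] //.
  right; split=> //; rewrite mdist_gt0; apply/eqP => eg; apply: ng.
  by split; [case: gk|rewrite /src -eg].
- case: gU => [[gO gf]|[U0 dg]].
    rewrite /graph_fun asboolT// -VE; split=> //.
  rewrite /graph_fun asboolF// => -[_]; rewrite /src /rng => gg.
  by move: dg; rewrite gg mdistxx ltxx.
Qed.

(** The support lies in the graph, which is compact as a continuous image of X, and closed as the
    locus where its continuous indicator is 1. *)
Lemma graph_fun_Cc k (f : X -> C) :
  continuous (f : X -> C^o) -> Cc (graph_fun k f).
Proof.
move=> cf; split; first exact: graph_fun_continuous.
have clo : closed (is_graph k).
  rewrite (_ : is_graph k = (graph_fun k (fun=> 1) : Gamma ->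
    C^o) @^-1` [set 1]).
    apply: closed_comp; last first.
      exact/accessible_closed_set1/hausdorff_accessible/(@norm_hausdorff C C^o).
    by move=> ? _; apply: graph_fun_continuous => ?; exact: cvg_cst.
  apply/seteqP; split => g /=; rewrite /graph_fun;
    case: asboolP => // _ /esym/eqP.
  by rewrite oner_eq0.
apply: (@subclosed_compact _ _ (is_graph k)); first exact: closed_closure.
  rewrite (_ : is_graph k = graph k @` setT).
    apply: continuous_compact => //; apply: continuous_subspaceT.
    exact: graph_continuous.
  by apply/seteqP; split => [g /is_graphP ->|_ [x _ <-]];
    [exists (rng g)|split].
move/closure_id: clo => ->; apply: closure_subset => g /=.
by rewrite /graph_fun; case: asboolP => //; rewrite eqxx.
Qed.

End graph_topology.

(** * Products of functions carried by graphs *)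

Section convolution.
Variables (R : realType) (X : topologicalType) (phi : X -> X).
Local Notation Gamma := (gpd phi).
Local Notation C := R[i].
Local Notation graph_fun := (@graph_fun R X phi).
Local Notation graph := (@graph X phi).

Definition transfer (d : X -> C) (y : X) : C :=
  \sum_(x \in [set x | phi x = y]) d x.

Lemma convolution1 (f1 f2 : Gamma -> C) g g1 g2 :
  gpd_prod g1 g2 g ->
  (forall p1 p2, gpd_prod p1 p2 g -> (p1, p2) <> (g1,
    g2) -> f1 p1 * f2 p2 = 0) ->
  convolution f1 f2 g = f1 g1 * f2 g2.
Proof.
move=> gP h; rewrite /convolution -(fsbig_widen [set (g1, g2)]) ?fsbig_set1//.
  by move=> _ ->.
by move=> [p1 p2] [/= pP pg]; exact: h.
Qed.

Lemma on_units_graph_fun (d : X ->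
  C) : on_units d = graph_fun 0 d :> (Gamma -> C).
Proof.
apply/funext => g; rewrite /on_units /graph_fun /is_unit /is_graph /=.
by congr (if _ then _ else _); apply: asbool_equiv_eq; split=> -[-> ->].
Qed.

Lemma convolution_graph_fun k (d : X -> C) (f : Gamma -> C) g h :
  gpd_prod (graph k (rng g)) h g ->
  convolution (graph_fun k d) f g = d (rng g) * f h.
Proof.
move=> gh; rewrite (convolution1 gh).
  by rewrite /graph_fun asboolT//; exact/is_graphP.
move=> p1 p2 [p12 pr pl ps] np; rewrite {1}/graph_fun.
case: asboolP => [|_]; last by rewrite mul0r.
move=> /is_graphP p1E; case: np; rewrite pr -p1E; congr (_, _).
move: gh p12 pl ps; rewrite pr -p1E => -[gh1 gh2 gh3 gh4] p12 pl ps.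
apply: gpd_eq; first by rewrite -p12 gh1.
  by apply: (addrI (lag p1)); rewrite -pl -gh3.
by rewrite -ps gh4.
Qed.

Lemma convolution_units_l (d : X -> C) (f : Gamma -> C) :
  convolution (on_units d) f = (fun g => d (rng g) * f g).
Proof.
apply/funext => g; rewrite on_units_graph_fun (@convolution_graph_fun _ _ _ _
  g)//.
by split => //; rewrite /= add0r.
Qed.

Lemma convolution_units_r (d : X -> C) (f : Gamma -> C) :
  convolution f (on_units d) = (fun g => f g * d (src g)).
Proof.
apply/funext => g; rewrite on_units_graph_fun (@convolution1 _ _ _ g (graph 0
  (src g))).
- by rewrite /graph_fun asboolT//; exact/is_graphP.
- by split => //; rewrite /= addr0.
- move=> p1 p2 [p12 pr pl ps] np; rewrite {1}/graph_fun.
  case: asboolP => [[pl2 ps2]|_]; last by rewrite mulr0.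
  case: np; congr (_, _); last first.
    by apply: gpd_eq => //; rewrite ?ps ?ps2.
  apply: gpd_eq => //; first by rewrite pl pl2 addr0.
  by rewrite p12 ps ps2.
Qed.

Lemma convolution_units_graph_fun k (d d' : X -> C) :
  convolution (on_units d) (graph_fun k d') = graph_fun k (fun x => d x * d' x).
Proof.
rewrite convolution_units_l; apply/funext => g; rewrite /graph_fun.
by case: asboolP => // _; rewrite mulr0.
Qed.

Lemma convolution_graph_fun_units (d d' : X -> C) :
  convolution (graph_fun 1 d) (on_units d') =
  graph_fun 1 (fun x => d x * d' (phi x)).
Proof.
rewrite convolution_units_r; apply/funext => g; rewrite /graph_fun.
by case: asboolP => [[_ ->]//|]; rewrite mul0r.
Qed.

Lemma convolution_units (d d' : X -> C) :
  convolution (on_units d) (on_units d') =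
  on_units (fun x => d x * d' x) :> (Gamma -> C).
Proof. by rewrite !on_units_graph_fun -on_units_graph_fun
  convolution_units_graph_fun. Qed.

(** The first factor of an arrow (x, k, y) must be (x, 1, phi x), which leaves (phi x, k - 1, y);
    this is the inverse of an arrow (y, 1, phi y) only if k = 0 and phi x = phi y. The product may
    thus live off the unit space, until [graph_fun_mul_invol] localises it. *)
Lemma convolution_graph_fun_invol (d d' : X -> C) :
  convolution (graph_fun 1 d) (invol (graph_fun 1 d')) =
  (fun g => if `[< lag g = 0 /\ phi (src g) = phi (rng g) >]
            then d (rng g) * (d' (src g))^* else 0).
Proof.
apply/funext => g.
have hP : `[< @in_gpd X phi (phi (rng g)) (lag g - 1) (src g) >].
  apply/asboolP; have /asboolP[a [b [kE abE]]] := gpd_valP g.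
  exists a, b.+1; split; first by rewrite /lag kE -addn1 PoszD opprD addrA.
  by rewrite -iterSr !iterS; congr phi.
pose h : Gamma := @Gpd X phi (_, _, _) hP.
rewrite (@convolution_graph_fun 1 d _ g h); last first.
  by split => //; rewrite /lag /= addrC subrK.
have E : is_graph 1 (gpd_inv h) <-> lag g = 0 /\ phi (src g) = phi (rng g).
  rewrite /is_graph -[lag (gpd_inv h)]/(- (lag g - 1)) opprB.
  rewrite -[src (gpd_inv h)]/(phi (rng g)) -[rng (gpd_inv h)]/(src g) /=.
  split => -[lg pg]; split=> //; last by rewrite lg subr0.
  by apply: oppr_inj; apply: (addrI 1); rewrite oppr0 addr0.
rewrite /invol /graph_fun (asbool_equiv_eq E).
by case: asboolP => // _; rewrite rmorph0 mulr0.
Qed.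

(** The contributing factorizations are (phi x, -1, x) (x, 1, phi x), whose product is the unit at
    phi x; summing over x in a fibre produces the transfer operator. *)
Lemma convolution_invol_graph_fun (d d' : X -> C) :
  convolution (invol (graph_fun 1 d')) (graph_fun 1 d) =
  on_units (transfer (fun x => (d' x)^* * d x)).
Proof.
apply/funext => g; rewrite /on_units.
case: asboolP => [[lg rg]|ng]; last first.
  rewrite /convolution fsbig1// => -[p1 p2] [/= p12 pr pl ps].
  rewrite /invol /graph_fun /=; case: asboolP => [/is_graphP e1|]; last first.
    by rewrite rmorph0 mul0r.
  case: asboolP => [/is_graphP e2|]; last by rewrite mulr0.
  case: ng; move: pl ps; rewrite e2 /= -p12.
  have -> : p1 = gpd_inv (graph 1 (src p1)).
    have -> : graph 1 (src p1) = gpd_inv p1 by rewrite [RHS]e1.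
    by apply: gpd_eq => //=; rewrite /lag/= opprK.
  move=> pl ps; split; first by rewrite pl /lag /= addNr.
  by rewrite ps pr; exact: (congr1 (@src X phi) e1).
(* [h] parametrises by the preimages x the factorizations of the unit that can contribute. *)
pose h x := (gpd_inv (graph 1 x), graph 1 x).
rewrite /convolution -(fsbig_widen (h @` [set x | phi x = rng g])).
- rewrite fsbig_image; last by move=> x y _ _ [].
  apply: eq_fsbigr => x _ /=; rewrite /invol /graph_fun !asboolT//.
- by move=> _ [x /= xg <-]; split => //=; rewrite -?rg.
- move=> [p1 p2] [/= [p12 pr pl ps] np].
  rewrite /invol /graph_fun /=; case: asboolP => [/is_graphP e1|]; last first.
    by rewrite rmorph0 mul0r.
  case: asboolP => [/is_graphP e2|]; last by rewrite mulr0.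
  case: np; exists (rng p2).
    rewrite /= pr -p12; exact: esym (congr1 (@src X phi) e1).
  rewrite /h; congr (_, _); last by rewrite -e2.
  rewrite -p12.
  have -> : graph 1 (src p1) = gpd_inv p1 by rewrite [RHS]e1.
  by apply: gpd_eq => //=; rewrite /lag/= opprK.
Qed.

End convolution.

(** * Functions on the unit space that belong to the algebra *)

Section diagonal.
Variables (R : realType) (X : pointedMetricType R) (phi : X -> X).
Hypotheses (cX : compact [set: X]) (cphi : continuous phi)
  (inj : locally_injective phi).
Local Notation Gamma := (gpd phi).
Local Notation C := R[i].
Local Notation graph_fun := (@graph_fun R X phi).
Local Notation transfer := (@transfer R X phi).

(** This class contains C(X) and, unlike C(X), is stable under [transfer] for every [phi] considered
    here. *)
Definition diag (d : X -> C) : Prop := @alg R X phi (on_units d).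

Lemma alg_graph_fun k (f : X -> C) :
  continuous (f : X -> C^o) -> alg (graph_fun k f).
Proof. by move=> cf; apply: alg_Cc; exact: graph_fun_Cc. Qed.

Lemma diag_continuous (d : X -> C) : continuous (d : X -> C^o) -> diag d.
Proof. by move=> cd; rewrite /diag on_units_graph_fun;
  exact: alg_graph_fun. Qed.

Lemma diag_cst z : diag (fun=> z).
Proof. by apply: diag_continuous => x; exact: cvg_cst. Qed.

Lemma diagD d d' : diag d -> diag d' -> diag (fun x => d x + d' x).
Proof.
move=> hd hd'; rewrite /diag [on_units _](_ : _ = (fun g =>
  on_units d g + on_units d' g)).
  exact: alg_add.
by apply/funext => g; rewrite /on_units; case: ifP; rewrite ?addr0.
Qed.

Lemma diagM d d' : diag d -> diag d' -> diag (fun x => d x * d' x).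
Proof. by move=> hd hd'; rewrite /diag -(@convolution_units R X phi d d');
  exact: alg_convolution. Qed.

Lemma diag_sum (I : Type) (r : seq I) (d : I -> X -> C) :
  (forall i, diag (d i)) -> diag (fun x => \sum_(i <- r) d i x).
Proof.
move=> h; elim: r => [|i r IH].
  under eq_fun do rewrite big_nil.
  exact: diag_cst.
under eq_fun do rewrite big_cons.
exact: diagD.
Qed.

Lemma diag_prod (I : Type) (r : seq I) (P : pred I) (d : I -> X -> C) :
  (forall i, diag (d i)) -> diag (fun x => \prod_(i <- r | P i) d i x).
Proof.
move=> h; elim: r => [|i r IH].
  under eq_fun do rewrite big_nil.
  exact: diag_cst.
under eq_fun do rewrite big_cons.
by case: (P i) => //; exact: diagM.
Qed.

Lemma alg_graph_funM (d f : X -> C) :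
  diag d -> alg (graph_fun 1 f) -> alg (graph_fun 1 (fun x => d x * f x)).
Proof. by move=> hd hf; rewrite -(@convolution_units_graph_fun R X phi 1 d f);
  exact: alg_convolution. Qed.

(** With w the indicator of the graph of [phi], the transfer of d is the product of the adjoint of
    w, of d and of w. *)
Lemma diag_transfer (d : X -> C) : diag d -> diag (transfer d).
Proof.
move=> hd; have W : alg (graph_fun 1 (fun=> 1)).
  by apply: alg_graph_fun => x; exact: cvg_cst.
have := alg_convolution (alg_invol W) (alg_graph_funM hd W).
rewrite convolution_invol_graph_fun; congr (alg (on_units (transfer _))).
by apply/funext => x; rewrite rmorph1 mul1r mulr1.
Qed.

(** An arrow (x, 0, y) with phi x = phi y at which the product is nonzero joins two e-close points
    of one fibre, so it is a unit. *)
Lemma graph_fun_mul_invol (h d : X -> C) (e : R) :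
  (forall x y, mdist x y < e -> phi x = phi y -> x = y) ->
  (forall x y, d x != 0 -> h y != 0 -> mdist x y < e) ->
  convolution (graph_fun 1 d) (invol (graph_fun 1 h)) =
  on_units (fun x => d x * (h x)^*).
Proof.
move=> eP he; rewrite convolution_graph_fun_invol; apply/funext => g.
rewrite /on_units; case: asboolP => [[lg pg]|ng].
  case: asboolP => [[_ rg]|ng]; first by rewrite rg.
  apply/eqP; rewrite mulf_eq0 conjC_eq0; apply/negP => /negP; rewrite negb_or.
  move=> /andP[d0 h0]; apply: ng; split=> //; apply: eP => //; exact: he.
by case: asboolP => // -[lg rg]; case: ng; rewrite rg.
Qed.

Lemma real_complex_continuous (f : X -> R) :
  continuous f -> continuous ((fun x => (f x)%:C) : X -> C^o).
Proof.
move=> cf x; apply/(@cvgrPdist_lt _ C^o) => e e0.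
have eE : e = (complex.Re e)%:C by rewrite RRe_real// gtr0_real.
move: e0; rewrite eE ltcR => e0; have /cvgrPdist_lt/(_ _ e0) := cf x.
apply: filterS => y /=.
by rewrite -raddfB normc_def /= expr0n/= addr0 sqrtr_sqr ltcR.
Qed.

(* Under [complex_scope] the notation [^*] means [conjc], except below ring
   operations, where it means [Num.conj]; [%R] selects the latter. *)
Lemma complex_partition (e : R) : 0 < e ->
  exists (m : nat) (h : 'I_m -> X -> C),
  [/\ forall i, continuous (h i : X -> C^o),
      forall i x, (h i x)^*%R = h i x,
      forall i x y, h i x != 0 -> h i y != 0 -> mdist x y < e &
      forall x, \sum_(i < m) h i x * h i x = 1].
Proof.
move=> e0; have [m [h [h1 h2 h3]]] := partition_of_unity cX e0.
exists m, (fun i x => (h i x)%:C); split.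
- by move=> i; apply: real_complex_continuous.
- by move=> i x; exact: conj_real.
- move=> i x y hx hy; apply: (h2 i).
    by apply: contraNneq hx => ->.
  by apply: contraNneq hy => ->.
- move=> x; under eq_bigr do rewrite -rmorphM/= -expr2.
  by rewrite -rmorph_sum /= h3.
Qed.

(** With w_i carried by the graph of [phi] with coefficient h_i, the product of w_i, of d and of the
    adjoint of w_i is h_i^2 times d composed with [phi]; the sum over i removes the h_i^2. *)
Lemma diag_comp (d : X -> C) : diag d -> diag (fun x => d (phi x)).
Proof.
move=> hd; have [e e0 eP] := locally_injective_uniform cX inj.
have [m [h [hc hr hs h1]]] := complex_partition e0.
rewrite (_ : (fun x => _) = (fun x =>
  \sum_(i < m) h i x * d (phi x) * (h i x)^*)).
  apply: diag_sum => i; rewrite /diag -(graph_fun_mul_invol eP).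
    apply: alg_convolution; last by apply: alg_invol; exact: alg_graph_fun.
    rewrite -(@convolution_graph_fun_units R X phi (h i) d);
      apply: alg_convolution => //.
    exact: alg_graph_fun.
  by move=> x y; rewrite mulf_eq0 negb_or => /andP[hx _]; exact: hs.
apply/funext => x; rewrite -[LHS]mul1r -(h1 x) mulr_suml.
by apply: eq_bigr => i _; rewrite hr mulrAC.
Qed.

Lemma transfer1 y : transfer (fun=> 1) y = (npreimages phi 1 y)%:R.
Proof.
exact: esym (npreimages_sum C (finite_preimage1 cX inj) 1 y).
Qed.

(* Lagrange interpolation at the finitely many values of [n]. *)
Lemma diag_nat_comp (K : nat) (n : X -> nat) (q : nat -> C) :
  (forall x, n x <= K)%N -> diag (fun x => (n x)%:R) -> diag (fun x => q (n x)).
Proof.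
move=> nK hn.
pose I k x : C := \prod_(j < K.+1 | j != k) (((n x)%:R - j%:R) * (k%:R -
  j%:R)^-1).
have IE k x : I k x = (n x == k)%:R.
  have [nk|nk] := eqVneq (n x) k.
    by rewrite /I big1// => j jk; rewrite nk divff// subr_eq0 eqr_nat eq_sym.
  have nx : (n x < K.+1)%N by rewrite ltnS.
  by rewrite /I (bigD1 (Ordinal nx))//= subrr !mul0r.
rewrite (_ : (fun x => _) = (fun x => \sum_(k < K.+1) q k * I k x)).
  apply: diag_sum => k; apply: diagM; first exact: diag_cst.
  apply: diag_prod => j; apply: diagM; last exact: diag_cst.
  by apply: diagD => //; exact: diag_cst.
apply/funext => x; have nx : (n x < K.+1)%N by rewrite ltnS.
rewrite (bigD1 (Ordinal nx))//= big1 ?addr0 ?IE ?eqxx ?mulr1// => k kn.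
rewrite IE; have [nk|] := eqVneq (n x) k; last by rewrite mulr0.
by move: kn; rewrite -(inj_eq val_inj)/= nk eqxx.
Qed.

(** The count is the transfer of 1 composed with [phi], and it is bounded, so interpolation applies.
    Both the square root and its inverse will be taken for q: the inverse puts [Vphi] in [alg], the
    root recovers w_i from [Vphi]. *)
Lemma diag_npreimages (q : nat -> C) :
  diag (fun x => q (npreimages phi 1 (phi x))).
Proof.
have [K hK] := finite_preimage cX inj.
apply: (@diag_nat_comp K); first by move=> x; have [] := hK (phi x).
under eq_fun do rewrite -transfer1.
by apply: (@diag_comp (transfer _)); apply: diag_transfer; exact: diag_cst.
Qed.

Lemma npreimages1_gt0 x : (0 < npreimages phi 1 (phi x))%N.
Proof.
have fin := finite_preimage1 cX inj (phi x).
rewrite cardfs_gt0; apply/fset0Pn; exists x.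
by rewrite in_fset_set ?inE.
Qed.

Lemma VphiE : @Vphi R X phi = graph_fun 1
  (fun x => ((Num.sqrt (npreimages phi 1 (phi x))%:R)^-1)%:C).
Proof. by []. Qed.

Lemma alg_Vphi : alg (@Vphi R X phi).
Proof.
rewrite VphiE (_ : (fun x => _) =
  (fun x => ((Num.sqrt (npreimages phi 1 (phi x))%:R)^-1)%:C * 1)).
  apply: alg_graph_funM.
    exact: (@diag_npreimages (fun n => ((Num.sqrt n%:R)^-1)%:C)).
  by apply: alg_graph_fun => x; exact: cvg_cst.
by apply/funext => x; rewrite mulr1.
Qed.

(** This makes the action computable on w_i, since it is prescribed on the diagonal and on
    [Vphi]. *)
Lemma graph_fun_Vphi (h : X -> C) : graph_fun 1 h =
  convolution (on_units (fun x =>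
    h x * (Num.sqrt (npreimages phi 1 (phi x))%:R)%:C))
    (@Vphi R X phi).
Proof.
rewrite VphiE convolution_units_graph_fun; congr graph_fun.
apply/funext => x; rewrite -mulrA -rmorphM/= divff ?mulr1//.
by rewrite sqrtr_eq0 -ltNge ltr0n npreimages1_gt0.
Qed.

End diagonal.

(** * Analytic elements and the KMS condition *)

Section complex_exponential.
Variable R : realType.
Implicit Types (a b x : R) (w z : R[i]).

(** The mean value theorem for sin, then cos, then sin again, each bound feeding the next; the
    constants are those it gives, not the sharp 1/2 and 1/6. *)
Lemma sin_cos_bounds_ge0 b : 0 <= b ->
  [/\ `|sin b| <= b, 0 <= 1 - cos b <= b ^+ 2 & `|b - sin b| <= b ^+ 3].
Proof.
have sin_le (c : R) : 0 <= c -> `|sin c| <= c.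
  rewrite le_eqVlt => /predU1P[<-|c0]; first by rewrite sin0 normr0.
  have [|x _] := @MVT R sin cos 0 c c0 (fun x _ => is_derive_sin x).
    by apply: continuous_subspaceT => x; exact: continuous_sin.
  rewrite sin0 !subr0 => ->; rewrite normrM (gtr0_norm c0).
  by rewrite ler_piMl ?cos_max// ltW.
have cos_le (c : R) : 0 <= c -> 0 <= 1 - cos c <= c ^+ 2.
  move=> c0; rewrite subr_ge0 cos_le1 /=; move: c0.
  rewrite le_eqVlt => /predU1P[<-|c0]; first by rewrite cos0 subrr expr0n.
  have [|x] := @MVT R cos (fun x => - sin x) 0 c c0 (fun x _ =>
    is_derive_cos x).
    by apply: continuous_subspaceT => x; exact: continuous_cos.
  rewrite in_itv/= cos0 => /andP[x0 xc] h.
  have := sin_le x (ltW x0); rewrite ler_norml => /andP[_ sx].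
  nra.
move=> b0; split; [exact: sin_le|exact: cos_le|].
move: b0; rewrite le_eqVlt => /predU1P[<-|b0].
  by rewrite sin0 subrr normr0 expr0n.
have [|x] := @MVT R sin cos 0 b b0 (fun x _ => is_derive_sin x).
  by apply: continuous_subspaceT => x; exact: continuous_sin.
rewrite in_itv/= sin0 !subr0 => /andP[x0 xb] ->.
have /andP[c0 c1] := cos_le x (ltW x0).
rewrite ger0_norm; last by nra.
have -> : b - cos x * b = (1 - cos x) * b by ring.
rewrite exprSr ler_pM2r//; apply: le_trans c1 _.
by nra.
Qed.

Lemma sin_cos_bounds b : 
  [/\ `|sin b| <= `|b|, 0 <= 1 - cos b <= b ^+ 2 & `|b - sin b| <= `|b| ^+ 3].
Proof.
have [b0|b0] := leP 0 b; first by rewrite (ger0_norm b0);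
  exact: sin_cos_bounds_ge0.
have Nb0 : 0 <= - b by rewrite oppr_ge0 ltW.
have := sin_cos_bounds_ge0 Nb0; rewrite sinN cosN normrN sqrrN => -[h1 h2 h3].
by rewrite (ltr0_norm b0); split => //; rewrite -normrN opprD.
Qed.

(** Everything follows from exp x >= 1 + x at a and at -a; the latter reads exp a (1 - a) <= 1. *)
Lemma expR_bounds a : `|a| <= 2^-1 ->
  0 <= expR a - 1 - a <= 2 * a ^+ 2 /\ expR a <= 2.
Proof.
rewrite ler_norml => /andP[a1 a2]; have h1 := expR_ge1Dx a.
have := expR_ge1Dx (- a); rewrite expRN => h2.
have e0 := expR_gt0 a.
have h3 : expR a * (1 - a) <= 1.
  by rewrite -(@ler_pM2l _ (expR a)) // mulfV ?gt_eqF// in h2.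
by split; [apply/andP; split|]; nra.
Qed.

Definition cexp w : R[i] := (expR (complex.Re w))%:C * expi (complex.Im w).

Lemma expiD a b : expi (a + b) = expi a * expi b.
Proof. by rewrite /expi cosD sinD; simpc; congr (_ +i* _); rewrite addrC. Qed.

Lemma cexpD w z : cexp (w + z) = cexp w * cexp z.
Proof.
case: w z => [a b] [c d]; rewrite /cexp /= expRD expiD rmorphM/=.
by rewrite mulrACA.
Qed.

Lemma normc_le_Re_Im w : complex.Re `|w| <= `|complex.Re w| + `|complex.Im w|.
Proof.
rewrite normc_def /= -(@ler_pXn2r _ 2) ?nnegrE ?addr_ge0 ?sqrtr_ge0//.
rewrite sqr_sqrtr ?addr_ge0 ?sqr_ge0// sqrrD !real_normK ?num_real//.
by rewrite lerD2r lerDl mulrn_wge0// mulr_ge0.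
Qed.

(** For w = a + ib the real part of the remainder is at most 2 a^2 + 2 b^2 and the imaginary part at
    most 2 |a| |b| + b^2. As 2 |a| |b| <= a^2 + b^2, the sum is at most 4 (a^2 + b^2). *)
Lemma cexp_taylor w : complex.Re `|w| <= 2^-1 ->
  complex.Re `|cexp w - 1 - w| <= 4 * complex.Re `|w| ^+ 2.
Proof.
move=> w1; have w2 : complex.Re `|w| ^+ 2 =
  complex.Re w ^+ 2 + complex.Im w ^+ 2.
  by rewrite normc_def /= sqr_sqrtr// addr_ge0 ?sqr_ge0.
rewrite w2; have wge0 : 0 <= complex.Re `|w| by rewrite normc_def /= sqrtr_ge0.
have {w1}w1 : complex.Re w ^+ 2 + complex.Im w ^+ 2 <= 4^-1 by rewrite -w2; nra.
apply: le_trans (normc_le_Re_Im _) _; case: w w1 {w2 wge0} => a b /= ab.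
rewrite !mul0r !subr0 addr0.
have a1 : `|a| <= 2^-1.
  rewrite -(@ler_pXn2r _ 2) ?nnegrE// ?invr_ge0// real_normK ?num_real//.
  by have := sqr_ge0 b; lra.
have b1 : `|b| <= 2^-1.
  rewrite -(@ler_pXn2r _ 2) ?nnegrE// ?invr_ge0// real_normK ?num_real//.
  by have := sqr_ge0 a; lra.
have [/andP[p0 p1] e2] := expR_bounds a1.
have [s1 /andP[c0 c1] s3] := sin_cos_bounds b.
have e0 := expR_gt0 a.
have A2 : `|a| ^+ 2 = a ^+ 2 by rewrite real_normK ?num_real.
have B2 : `|b| ^+ 2 = b ^+ 2 by rewrite real_normK ?num_real.
have A0 := normr_ge0 a; have B0 := normr_ge0 b.
have h1 : `|expR a * cos b - 1 - a| <= 2 * a ^+ 2 + 2 * b ^+ 2.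
  have -> : expR a * cos b - 1 - a =
    (expR a - 1 - a) - expR a * (1 - cos b) by ring.
  rewrite ler_norml; apply/andP; split; nra.
have h2 : `|expR a * sin b - b| <= 2 * `|a| * `|b| + b ^+ 2.
  have -> : expR a * sin b - b = (expR a - 1) * sin b - (b - sin b) by ring.
  apply: le_trans (ler_normB _ _) _; rewrite normrM lerD//.
    apply: ler_pM => //.
    have -> : expR a - 1 = (expR a - 1 - a) + a by ring.
    apply: le_trans (ler_normD _ _) _; rewrite (ger0_norm p0); nra.
  by apply: le_trans s3 _; rewrite exprS B2; nra.
have := sqr_ge0 (`|a| - `|b|); rewrite sqrrB A2 B2; lra.
Qed.

End complex_exponential.

(** * The diagonal in the completion *)

Section reduced_algebra.
Variables (R : realType) (X : pointedMetricType R) (phi : X -> X).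
Variables (A : unitalCstarAlgebra R) (iota : (gpd phi -> R[i]) -> A).
Hypotheses (cX : compact [set: X]) (cphi : continuous phi)
  (inj : locally_injective phi) (hA : is_reduced_Cstar_algebra iota).
Local Notation Gamma := (gpd phi).
Local Notation C := R[i].
Local Notation graph_fun := (@graph_fun R X phi).
Local Notation transfer := (@transfer R X phi).
Local Notation diag := (@diag R X phi).
Local Notation delta d := (iota (on_units d)).

Lemma deltaD d d' : diag d -> diag d' ->
  delta (fun x => d x + d' x) = delta d + delta d'.
Proof.
move=> hd hd'; rewrite -(Defs.iotaD hA)//; congr iota; apply/funext => g.
by rewrite /on_units; case: ifP; rewrite ?addr0.
Qed.

Lemma deltaZ z d : diag d -> delta (fun x => z * d x) = z *: delta d.
Proof.
move=> hd; rewrite -(Defs.iotaZ hA)//; congr iota; apply/funext => g.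
by rewrite /on_units; case: ifP; rewrite ?mulr0.
Qed.

Lemma deltaM d d' : diag d -> diag d' ->
  delta (fun x => d x * d' x) = delta d \** delta d'.
Proof. by move=> hd hd'; rewrite -(iotaM hA)// convolution_units. Qed.

Lemma invol_units (d : X -> C) :
  invol (on_units d) = on_units (fun x => (d x)^*) :> (Gamma -> C).
Proof.
apply/funext => g; rewrite /invol /on_units.
have E : is_unit (gpd_inv g) <-> is_unit g.
  rewrite /is_unit -[lag (gpd_inv g)]/(- lag g) -[src (gpd_inv g)]/(rng g).
  rewrite -[rng (gpd_inv g)]/(src g); split => -[lg ->]; split => //.
    by apply/eqP; rewrite -oppr_eq0 lg.
  by rewrite lg oppr0.
rewrite (asbool_equiv_eq E); case: asboolP => [[_ rg]|_];
  last by rewrite rmorph0.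
by rewrite -[rng (gpd_inv g)]/(src g) rg.
Qed.

Lemma delta_adj d : diag d -> cstar_adj (delta d) = delta (fun x => (d x)^*).
Proof. by move=> hd; rewrite -(iota_adj hA)// invol_units. Qed.

(** In every pi_x, a function on the unit space acts by pointwise multiplication by d (rng g), a
    contraction of l^2. *)
Lemma rnorm_delta_le1 d : diag d ->
  (forall x, `|d x| <= 1) -> rnorm (delta d) <= 1.
Proof.
move=> hd d1; rewrite -lee_fin (iota_norm hA hd).
apply: ge_ereal_sup => _ [x _ <-]; apply: ge_ereal_sup => _ [xi [_ xi1] <-].
apply: le_trans xi1; rewrite convolution_units_l.
rewrite lee_sqrt; last first.
  by apply: esum_ge0 => g _;
    rewrite lee_fin -ler0c RRe_real ?exprn_ge0 ?realX ?normr_real.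
apply: le_esum => g _; rewrite lee_fin -lecR !RRe_real ?realX ?normr_real//.
by rewrite lerXn2r ?nnegrE// normrM ler_piMl.
Qed.

Lemma rnorm_delta_le (c : R) d : 0 < c -> diag d ->
  (forall x, `|d x| <= c%:C) ->
  rnorm (delta d) <= c.
Proof.
move=> c0 hd dc; have cC0 : 0 < c%:C by rewrite ltcR.
rewrite (_ : d = (fun x => c%:C * (c%:C^-1 * d x))); last first.
  by apply/funext => x; rewrite mulrA divff ?mul1r// gt_eqF.
have hd' : diag (fun x => c%:C^-1 * d x) by apply: diagM => //; exact: diag_cst.
rewrite deltaZ// rnormZ gtr0_norm//= ler_piMr ?(ltW c0)//;
  apply: rnorm_delta_le1 => // x.
by rewrite normrM ger0_norm ?invr_ge0 ?(ltW cC0)// mulrC ler_pdivrMr// mul1r.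
Qed.

Lemma delta1 : delta (fun=> 1) = cstar_one.
Proof.
suff h (a : A) : delta (fun=> 1) \** a = a by rewrite -[RHS]h cstar_mulr1.
apply/eqP; rewrite -subr_eq0; apply/eqP/rnorm_small_eq0 => e e0.
have : closure (iota @` @alg R X phi) a by rewrite (iota_dense hA).
set u := delta _.
have d0 : 0 < e / (rnorm u + 1).
  by rewrite divr_gt0// ltr_wpDl ?rnorm_ge0.
move=> /(_ (ball a (e / (rnorm u + 1))%:C)); case.
  by apply: nbhsx_ballx; rewrite ltcR.
move=> _ [[f af <-]]; rewrite -ball_normE /= rnormE ltcR => fa.
have uf : u \** iota f = iota f.
  rewrite -(iotaM hA) ?convolution_units_l//; last exact: diag_cst.
  by congr iota; apply/funext => g; rewrite mul1r.
have -> : u \** a - a = u \** (a - iota f) - (a - iota f).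
  by rewrite cstar_mulBr uf opprB addrA subrK.
apply: le_trans (rnormD _ _) _; rewrite rnormN.
have h := rnormM u (a - iota f).
have : rnorm (a - iota f) * (rnorm u +
  1) < e by rewrite -ltr_pdivlMr// ltr_wpDl ?rnorm_ge0.
lra.
Qed.

Section state.
Variable omega : A -> C.
Hypothesis om : is_state omega.

(** The square root is taken in [A]: u = c (1 - v), where v = 1 - u / c has values in [0, 1] and so
    norm at most 1. *)
Lemma state_delta_ge0 (u : X -> R) (c : R) : diag (fun x => (u x)%:C) ->
  (forall x, 0 <= u x <= c) -> 0 <= omega (delta (fun x => (u x)%:C)).
Proof.
move=> hu uc.
(* The bound c may be 0; it is enlarged so that it can be divided by. *)
have c1 : 0 < Num.max c 1 by rewrite lt_max ltr01 orbT.
have {uc}uc x : 0 <= u x <= Num.max c 1.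
  by have /andP[-> /=] := uc x; rewrite le_max => ->.
move: (Num.max c 1) c1 uc => {}c c0 uc.
pose v x : C := (1 - c^-1 * u x)%:C.
have hv : diag v.
  rewrite (_ : v = (fun x => 1 + (- (c^-1)%:C) * (u x)%:C)).
    by apply: diagD; [exact: diag_cst|apply: diagM => //; exact: diag_cst].
  by apply/funext => x; rewrite /v rmorphB rmorphM/= mulNr.
have uE : delta (fun x => (u x)%:C) = c%:C *: (cstar_one - delta v).
  rewrite -delta1 -scaleN1r -deltaZ// -deltaD;
    [|exact: diag_cst|by apply: diagM => //; exact: diag_cst].
  rewrite -deltaZ; last first.
    apply: diagD; first exact: diag_cst.
    by apply: diagM => //; exact: diag_cst.
  congr (iota (on_units _)); apply/funext => x.
  rewrite /v mulN1r -(rmorph1 (real_complex R)) -rmorphB -rmorphM /=.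
  by congr (_%:C); rewrite opprB addrC subrK mulrA divff ?mul1r// gt_eqF.
rewrite uE stateZ// mulr_ge0 ?ler0c ?(ltW c0)//;
  apply: state_ge0_one_minus => //.
  by rewrite delta_adj//; congr (iota (on_units _)); apply/funext => x;
    exact: conj_real.
apply: rnorm_delta_le1 => // x; have /andP[u0 u1] := uc x.
rewrite /v normc_def /= expr0n/= addr0 sqrtr_sqr lecR ler_norml.
have : c^-1 * u x <= 1 by rewrite mulrC ler_pdivrMr// mul1r.
have : 0 <= c^-1 * u x by rewrite mulr_ge0// invr_ge0 ltW.
by move=> *; apply/andP; split; lra.
Qed.

Lemma state_delta_bounds (u : X -> R) (a b : R) : diag (fun x => (u x)%:C) ->
  (forall x, a <= u x <= b) ->
  a%:C <= omega (delta (fun x => (u x)%:C)) <= b%:C.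
Proof.
move=> hu uab.
have hC (c s : R) : diag (fun x => (c + s * u x)%:C) /\
    omega (delta (fun x => (c + s * u x)%:C)) =
    c%:C + s%:C * omega (delta (fun x => (u x)%:C)).
  have -> : (fun x => (c + s * u x)%:C) = (fun x => c%:C * 1 + s%:C * (u x)%:C).
    by apply/funext => x; rewrite rmorphD rmorphM/= mulr1.
  have h1 : diag (fun=> c%:C * 1) by exact: diag_cst.
  have h2 : diag (fun x => s%:C * (u x)%:C) by apply: diagM => //;
    exact: diag_cst.
  split; first exact: diagD.
  rewrite deltaD// deltaZ; last exact: diag_cst.
  by rewrite deltaZ// stateD// !stateZ// delta1 (state1 om) mulr1.
set w := omega _ in hC *.
have e1 : (1 : R)%:C = 1 :> C by [].
apply/andP; split; rewrite -subr_ge0.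
  have [h1 h2] := hC (- a) 1.
  have -> : w - a%:C = (- a)%:C + 1%:C * w by rewrite rmorphN/= ?e1 mul1r addrC.
  rewrite -h2; apply: (@state_delta_ge0 _ (b - a)) => // x.
  by have /andP[? ?] := uab x; apply/andP; split; lra.
have [h1 h2] := hC b (- 1).
have -> : b%:C - w = b%:C + (- 1)%:C * w by rewrite rmorphN/= ?e1 mulN1r.
rewrite -h2; apply: (@state_delta_ge0 _ (b - a)) => // x.
by have /andP[? ?] := uab x; apply/andP; split; lra.
Qed.

End state.

End reduced_algebra.

Section phases.
Variables (R : realType) (X : pointedMetricType R) (phi : X -> X).
Variables (A : unitalCstarAlgebra R) (iota : (gpd phi -> R[i]) -> A).
Hypotheses (cX : compact [set: X]) (cphi : continuous phi)
  (inj : locally_injective phi) (hA : is_reduced_Cstar_algebra iota).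
Local Notation Gamma := (gpd phi).
Local Notation C := R[i].
Local Notation diag := (@diag R X phi).
Local Notation delta d := (iota (on_units d)).

(** This is exp (i z F), the factor by which alpha_z multiplies elements carried by the graph of
    [phi]; at z = i beta it is the weight exp (- beta F). *)
Definition phase (F : X -> R) (z : C) (x : X) : C := cexp ((F x)%:C * ('i * z)).

Lemma phaseD F z w x : phase F (z + w) x = phase F z x * phase F w x.
Proof. by rewrite /phase !mulrDr cexpD. Qed.

Lemma phaseE F (a b : R) x :
  phase F (a +i* b) x = (expR (- (F x * b)))%:C * expi (F x * a).
Proof.
rewrite /phase /cexp /=; congr ((expR _)%:C * expi _); by rewrite /=; ring.
Qed.

Lemma phase_real F (t : R) x : phase F t%:C x = expi (F x * t).
Proof. by rewrite phaseE mulr0 oppr0 expR0 mul1r. Qed.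

Lemma phase_imag F (b : R) x : phase F (0 +i* b) x = (expR (- (F x * b)))%:C.
Proof. by rewrite phaseE mulr0 /expi cos0 sin0 mulr1. Qed.

Lemma phase_conj F (t : R) x :
  (phase F t%:C x)^*%R = phase (fun x => - F x) t%:C x.
Proof. by rewrite !phase_real /expi mulNr cosN sinN. Qed.

Lemma diag_phase F z : continuous F -> diag (phase F z).
Proof.
case: z => a b cF.
have cD (c : R) (f : R -> R) : continuous f ->
    diag (fun x => (f (F x * c))%:C).
  move=> cf; apply: diag_continuous => //.
  apply: (@real_complex_continuous R X (fun x => f (F x * c))) => x.
  apply: (@continuous_comp _ _ _ (fun x => F x * c) f); last exact: cf.
  by apply: cvgM; [exact: cF|exact: cvg_cst].
rewrite (_ : phase F _ = (fun x => (expR (- (F x * b)))%:C *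
   ((cos (F x * a))%:C + 'i * (sin (F x * a))%:C))); last first.
  by apply/funext => x; rewrite phaseE; congr (_ * _); rewrite /expi; simpc.
apply: diagM.
  rewrite (_ : (fun x => _) = (fun x => (expR (F x * - b))%:C)).
    by apply: (@cD _ expR) => x; exact: continuous_expR.
  by apply/funext => x; rewrite mulrN.
apply: diagD; first by apply: (@cD _ cos) => x; exact: continuous_cos.
apply: diagM; first exact: diag_cst.
by apply: (@cD _ sin) => x; exact: continuous_sin.
Qed.

(** [cexp_taylor] at w = i h F x bounds the remainder, divided by |h|, by 4 B^2 |h|, uniformly in x;
    the supremum norm controls the norm of [A]. *)
Lemma phase_derivative F (h : C) (B : R) : continuous F -> 0 < B ->
  (forall x, `|F x| <= B) -> h != 0 -> complex.Re `|h| * B <= 2^-1 ->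
  rnorm (h^-1 *: (delta (phase F h) - cstar_one) -
         delta (fun x => 'i * (F x)%:C)) <= 4 * B ^+ 2 * complex.Re `|h|.
Proof.
move=> cF B0 FB h0 hB.
have hF : diag (fun x => 'i * (F x)%:C).
  apply: diagM; first exact: diag_cst.
  by apply: diag_continuous => //; exact: real_complex_continuous.
have hp := diag_phase h cF.
have h1 : diag (fun x => phase F h x + -1) by apply: diagD => //;
  exact: diag_cst.
have h2 : diag (fun x => h^-1 * (phase F h x + -1)).
  by apply: diagM => //; exact: diag_cst.
have h3 : diag (fun x => -1 * ('i * (F x)%:C)) by apply: diagM => //;
  exact: diag_cst.
have -> : h^-1 *: (delta (phase F h) - cstar_one) - delta (fun x =>
  'i * (F x)%:C) =
    delta (fun x => h^-1 * (phase F h x + -1) + -1 * ('i * (F x)%:C)).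
  rewrite (deltaD hA h2 h3) (deltaZ hA _ h1) (deltaZ hA _ hF) scaleN1r.
  rewrite (deltaD hA hp (diag_cst cX cphi inj (-1))).
  have -> : delta (fun=> -1) = - cstar_one.
    rewrite (_ : (fun=> -1) = (fun x : X => -1 * 1));
      last by apply/funext => x; rewrite mulr1.
    by rewrite (deltaZ hA _ (diag_cst cX cphi inj 1)) (delta1 cX cphi inj hA)
      scaleN1r.
  by [].
have hn : 0 < complex.Re `|h| by rewrite -ltcR RRe_real ?normr_real// normr_gt0.
have nE : `|h| = (complex.Re `|h|)%:C by rewrite RRe_real ?normr_real.
apply: (rnorm_delta_le cX cphi inj hA) => //.
- by rewrite !mulr_gt0// exprn_gt0.
- exact: diagD.
- move=> x.
  set w := (F x)%:C * ('i * h).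
  have wn : complex.Re `|w| <= complex.Re `|h| * B.
    rewrite -lecR realCM -nE RRe_real ?normr_real// /w !normrM.
    rewrite (_ : `|'i| = 1);
      last by rewrite normc_def /= expr0n expr1n add0r sqrtr1.
    rewrite mul1r mulrC ler_wpM2l//.
    by rewrite normc_def /= expr0n/= addr0 sqrtr_sqr lecR.
  have wE : h^-1 * (phase F h x + -1) + -1 * ('i * (F x)%:C) =
    h^-1 * (cexp w - 1 - w).
    rewrite [in RHS]mulrBr; congr (_ + _); rewrite /w mulN1r; congr (- _).
    by rewrite 2!(mulrCA h^-1) mulVf// mulr1 mulrC.
  have h4 := cexp_taylor (le_trans wn hB).
  rewrite wE; clearbody w => {wE}.
  rewrite normrM normfV nE -fmorphV.
  rewrite -(RRe_real (normr_real (cexp w - 1 - w))) -realCM lecR.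
  rewrite mulrC ler_pdivrMr//; apply: le_trans h4 _.
  have w0 : 0 <= complex.Re `|w| by rewrite -ler0c RRe_real ?normr_real.
  nra.
Qed.

(** [phaseD] reduces the difference quotient at z to the one at 0. The factors a and b allow for the
    phase in front of w as well as between the adjoint of w and d. *)
Lemma phase_derivable F (a b : A) (z : C) : continuous F ->
  derivable ((fun z => a \** delta (phase F z) \** b) : C^o -> A) z 1.
Proof.
move=> cF; have [B B0 FB] := compact_continuous_bounded cX cF.
have D w w' : delta (phase F (w + w')) =
  delta (phase F w) \** delta (phase F w').
  rewrite -(deltaM hA); [|exact: diag_phase|exact: diag_phase].
  by congr (iota (on_units _)); apply/funext => x; rewrite phaseD.
apply/cvg_ex; exists (a \** delta (phase F z) \** delta (fun x =>
  'i * (F x)%:C) \** b).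
apply/rnorm_cvgP => e e0.
pose M := rnorm (a \** delta (phase F z)) * (4 * B ^+ 2) * rnorm b + 1.
have M0 : 0 < M.
  by rewrite ltr_wpDl// !mulr_ge0 ?rnorm_ge0 ?exprn_ge0 ?ltW.
(* The first bound keeps |h| B <= 1/2, the range of [phase_derivative]; the second makes the error
   less than e. *)
pose r := Num.min (2^-1 / B) (e / M).
have r0 : 0 < r by rewrite lt_min !divr_gt0// invr_gt0.
apply/nbhs_ballP; exists r%:C; first by rewrite /= ltcR.
move=> h; rewrite -ball_normE /= sub0r normrN => hr h0.
move: hr; rewrite -(RRe_real (normr_real h)) ltcR lt_min => /andP[hr1 hr2].
have hB : complex.Re `|h| * B <= 2^-1 by rewrite -ler_pdivlMr// ltW.
have := phase_derivative cF B0 FB h0 hB.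
set q := h^-1 *: _; set l := delta (fun x => 'i * (F x)%:C) => ql.
have hzE : h *: (1 : C^o) + z = z + h by rewrite addrC; congr (_ + _);
  exact: mulr1.
have qE : h^-1 *: (a \** delta (phase F (z + h)) \** b -
    a \** delta (phase F z) \** b) = a \** delta (phase F z) \** q \** b.
  rewrite D -cstar_mulBl cstar_scaleAl; congr (_ \** _).
  rewrite /q -[in RHS]cstar_scaleAr; congr (_ *: _).
  by rewrite cstar_mulBr cstar_mulr1 cstar_mulA.
rewrite [X in _ - X](_ : _ = a \** delta (phase F z) \** q \** b); last first.
  by rewrite -qE -hzE.
rewrite -cstar_mulBl -cstar_mulBr.
have h1 := rnormM (a \** delta (phase F z) \** (l - q)) b.
have h2 := rnormM (a \** delta (phase F z)) (l - q).
rewrite rnormB in ql.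
move: hr2; rewrite ltr_pdivlMr// => hM.
apply: le_lt_trans h1 _; apply: le_lt_trans hM.
apply: (@le_trans _ _ (rnorm (a \** delta (phase F z)) * (4 * B ^+ 2 *
  complex.Re `|h|) * rnorm b)).
  apply: ler_wpM2r; first exact: rnorm_ge0.
  by apply: le_trans h2 _; apply: ler_wpM2l => //; exact: rnorm_ge0.
have hn : 0 <= complex.Re `|h| by rewrite -ler0c RRe_real ?normr_real.
by rewrite /M; lra.
Qed.

End phases.

(** * The KMS condition on the diagonal *)

Section kms.
Variables (R : realType) (X : pointedMetricType R) (phi : X -> X).
Variables (A : unitalCstarAlgebra R) (iota : (gpd phi -> R[i]) -> A).
Hypotheses (cX : compact [set: X]) (cphi : continuous phi)
  (inj : locally_injective phi) (hA : is_reduced_Cstar_algebra iota).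
Local Notation Gamma := (gpd phi).
Local Notation C := R[i].
Local Notation diag := (@diag R X phi).
Local Notation graph_fun := (@graph_fun R X phi).
Local Notation transfer := (@transfer R X phi).
Local Notation delta d := (iota (on_units d)).

Variables (F : X -> R) (beta : R) (alpha : R -> A -> A) (omega : A -> C).
Hypotheses (cF : continuous F) (al : is_alpha iota F alpha)
  (kms : is_KMS_state alpha beta omega).

Let om : is_state omega := proj1 kms.

Lemma alpha_delta t d : diag d -> alpha t (delta d) = delta d.
Proof.
move=> hd; apply: (alpha_diag al); apply: subset_closure.
exists (on_units d) => //; split=> // g.
by rewrite /on_units; case: asboolP => //; rewrite eqxx.
Qed.

Lemma alpha_graph_fun t (h : X -> C) : continuous (h : X -> C^o) ->
  alpha t (iota (graph_fun 1 h)) =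
  delta (phase F t%:C) \** iota (graph_fun 1 h).
Proof.
move=> ch; pose s x : C := h x * (Num.sqrt (npreimages phi 1 (phi x))%:R)%:C.
have hs : diag s.
  apply: diagM; first exact: diag_continuous.
  exact: (@diag_npreimages R X phi cX cphi inj (fun n => (Num.sqrt n%:R)%:C)).
have hV := alg_Vphi cX cphi inj.
have hE : iota (graph_fun 1 h) = delta s \** iota (@Vphi R X phi).
  by rewrite (graph_fun_Vphi cX inj) (iotaM hA).
have hp := diag_phase cX cphi inj t%:C cF.
have pE : on_units (fun x =>
  expi (F x * t)) = on_units (phase F t%:C) :> (Gamma -> C).
  by congr on_units; apply/funext => x; rewrite phase_real.
rewrite hE (autM (alpha_aut al t)) alpha_delta// (alpha_V al) pE.
rewrite !cstar_mulA -!(deltaM hA)//; congr (iota (on_units _) \** _).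
by apply/funext => x; rewrite mulrC.
Qed.

Lemma kms_graph_fun (h d : X -> C) : continuous (h : X -> C^o) -> diag d ->
  let w := iota (graph_fun 1 h) in
  omega (w \** (cstar_adj w \** delta d)) =
  omega (cstar_adj w \** delta d \** (delta (phase F (0 +i* beta)) \** w)).
Proof.
move=> ch hd w; have [_ k] := kms.
have cNF : continuous (fun x => - F x) by move=> x; apply: cvgN; exact: cF.
(* The extension for the adjoint of w uses the phase of -F: at real times it agrees with the
   conjugate phase, whereas conjugating at complex z would not be holomorphic. *)
apply: (k w (cstar_adj w \** delta d) (fun z => delta (phase F z) \** w)
  (fun z => cstar_adj w \** delta (phase (fun x => - F x) z) \** delta d)).
- split => [z|t]; last by rewrite alpha_graph_fun.
  rewrite (_ : (fun z => _) = (fun z => cstar_one \** delta (phase F z) \** w)).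
    exact: phase_derivable.
  by apply/funext => z'; rewrite cstar_mul1.
- split => [z|t]; first exact: (phase_derivable cX cphi inj hA).
  have hp := diag_phase cX cphi inj t%:C cF.
  rewrite (autM (alpha_aut al t)) alpha_delta// (aut_adj (alpha_aut al t)).
  rewrite alpha_graph_fun// cstar_adjM (delta_adj hA)//.
  congr (_ \** iota (on_units _) \** _); apply/funext => x.
  exact: esym (phase_conj _ _ _).
Qed.

Lemma state_delta_sum (I : Type) (r : seq I) (d : I -> X -> C) :
  (forall i, diag (d i)) ->
  omega (delta (fun x => \sum_(i <- r) d i x)) =
    \sum_(i <- r) omega (delta (d i)).
Proof.
move=> hd; elim: r => [|i r IH].
  under eq_fun do rewrite big_nil.
  have -> : (fun=> 0) = (fun x : X => 0 * 1 : C) by apply/funext => x;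
    rewrite mul0r.
  rewrite (deltaZ hA); last exact: diag_cst.
  by rewrite scale0r state0// big_nil.
under eq_fun do rewrite big_cons.
rewrite (deltaD hA)//; last exact: diag_sum.
by rewrite stateD// IH big_cons.
Qed.

Lemma transfer_sum (m : nat) (d : 'I_m -> X -> C) y :
  \sum_(i < m) transfer (d i) y = transfer (fun x => \sum_(i < m) d i x) y.
Proof.
have fin := finite_preimage1 cX inj y.
rewrite /transfer fsbig_finite//= exchange_big /=; apply: eq_bigr => i _.
by rewrite fsbig_finite.
Qed.

Lemma state_transfer (d : X -> C) : diag d ->
  omega (delta d) =
  omega (delta (transfer (fun x => d x * (expR (- (F x * beta)))%:C))).
Proof.
move=> hd; have [e e0 eP] := locally_injective_uniform cX inj.
have [m [h [hc hr hs h1]]] := complex_partition cX e0.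
pose p := phase F (0 +i* beta).
have hp : diag p by exact: diag_phase.
have ah i : alg (graph_fun 1 (h i)) by exact: alg_graph_fun.
have dh i : diag (h i) by exact: diag_continuous.
have hl i : diag (fun x => h i x * h i x * d x) by do 2?apply: diagM.
have hi i : diag (fun x => d x * p x * h i x) by do 2?apply: diagM.
have tE i : transfer (fun x => (h i x)^*%R * (d x * (p x * h i x))) =
    transfer (fun x => h i x * h i x * d x * p x).
  by congr transfer; apply/funext => x; rewrite hr; ring.
have key i : omega (delta (fun x => h i x * h i x * d x)) =
    omega (delta (transfer (fun x => h i x * h i x * d x * p x))).
  have := kms_graph_fun (hc i) hd.
  rewrite /= -(iota_adj hA)// cstar_mulA -(iotaM hA)//; last exact: alg_invol.
  rewrite (graph_fun_mul_invol eP); last exact: hs.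
  rewrite (_ : (fun x => h i x * (h i x)^*%R) = (fun x => h i x * h i x));
    last first.
    by apply/funext => x; rewrite hr.
  rewrite -(deltaM hA)//; last exact: diagM.
  move=> ->; rewrite -cstar_mulA -!(iotaM hA)//; try exact: alg_invol.
  - by rewrite !convolution_units_graph_fun convolution_invol_graph_fun tE.
  - rewrite !convolution_units_graph_fun.
    by apply: alg_graph_funM => //; apply: alg_graph_funM.
  - by rewrite convolution_units_graph_fun; apply: alg_graph_funM.
transitivity (omega (delta (fun x => \sum_(i < m) h i x * h i x * d x))).
  congr (omega (iota (on_units _))); apply/funext => x.
  by rewrite -mulr_suml h1 mul1r.
have dt i : diag (transfer (fun x => h i x * h i x * d x * p x)).
  by apply: diag_transfer => //; apply: diagM.
rewrite state_delta_sum// (eq_bigr _ (fun i _ => key i)) -state_delta_sum//.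
congr (omega (iota (on_units _))); apply/funext => y.
rewrite transfer_sum; congr (transfer _ y); apply/funext => x.
by rewrite -!mulr_suml h1 mul1r /p phase_imag.
Qed.

(** The function G_n, a partition function of thermodynamic formalism, in the recursive form that
    [state_transfer] handles; [gibbsE] is the closed form. *)
Fixpoint gibbs (n : nat) (y : X) : R :=
  if n is n'.+1
  then \sum_(x \in [set x | phi x = y]) gibbs n' x * expR (- (F x * beta))
  else 1.

Lemma state_gibbs n : diag (fun x => (gibbs n x)%:C) /\
  omega (delta (fun x => (gibbs n x)%:C)) = 1.
Proof.
elim: n => [|n [IH1 IH2]].
  split; first exact: (diag_cst cX cphi inj 1).
  by rewrite (delta1 cX cphi inj hA) (state1 om).
have E : (fun y => (gibbs n.+1 y)%:C) =
    transfer (fun x => (gibbs n x)%:C * (expR (- (F x * beta)))%:C).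
  apply/funext => y; have fin := finite_preimage1 cX inj y.
  rewrite /transfer /= !fsbig_finite//= (rmorph_sum (real_complex R)) /=.
  by apply: eq_bigr => x _; rewrite realCM.
rewrite E; split; last by rewrite -state_transfer.
apply: diag_transfer => //; apply: diagM => //.
rewrite (_ : (fun x => _) = phase F (0 +i* beta)); first exact: diag_phase.
by apply/funext => x; rewrite phase_imag.
Qed.

Definition birkhoff (n : nat) (x : X) : R := \sum_(j < n) F (iter j phi x).

Lemma gibbsE n y : gibbs n y =
  \sum_(x \in [set x | iter n phi x = y]) expR (- (birkhoff n x * beta)).
Proof.
have fin := finite_preimage1 cX inj.
elim: n y => [|n IH] y.
  rewrite /= (_ : [set _ | _] = [set y])// fsbig_set1.
  by rewrite /birkhoff big_ord0 mul0r oppr0 expR0.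
(* The last step of the orbit is split off: the fibre of phi^(n+1) over y is grouped by x = phi^n z
   with phi x = y, and F x is the last Birkhoff term. *)
rewrite -addn1 addnC (fiber_sum fin) addnC addn1 /=.
rewrite !fsbig_finite//=; apply: eq_big_seq => x _.
rewrite IH !fsbig_finite/=; [|exact: finite_fiber|exact: finite_fiber].
rewrite mulr_suml; apply: eq_big_seq => z.
rewrite in_fset_set ?inE/=; last exact: finite_fiber.
move=> zx; rewrite -expRD /birkhoff big_ord_recr /= zx.
by congr expR; ring.
Qed.

Lemma gibbs_le n y (s : R) : (forall x, s <= birkhoff n x * beta) ->
  gibbs n y <= (npreimages phi n y)%:R * expR (- s).
Proof.
move=> h; have fin := finite_preimage1 cX inj.
rewrite gibbsE (npreimages_sum _ fin) !fsbig_finite;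
  [|exact: finite_fiber|exact: finite_fiber].
rewrite /= mulr_suml; apply: ler_sum => x _.
by rewrite mul1r ler_expR lerN2.
Qed.

Lemma gibbs_ge n y (s : R) : (forall x, birkhoff n x * beta <= s) ->
  (npreimages phi n y)%:R * expR (- s) <= gibbs n y.
Proof.
move=> h; have fin := finite_preimage1 cX inj.
rewrite gibbsE (npreimages_sum _ fin) !fsbig_finite;
  [|exact: finite_fiber|exact: finite_fiber].
rewrite /= mulr_suml; apply: ler_sum => x _.
by rewrite mul1r ler_expR lerN2.
Qed.

(** Otherwise [gibbs n] <= N exp (- ln N - 1) = exp (-1) everywhere, against the value 1 that
    [omega] gives it. *)
Lemma kms_birkhoff_min n (N : nat) : (0 < N)%N ->
  (forall y, npreimages phi n y <= N)%N ->
  exists x, birkhoff n x * beta <= ln N%:R + 1.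
Proof.
move=> N0 hN; apply: contrapT => /forallNP h.
have {}h x : ln N%:R + 1 <= birkhoff n x * beta.
  by rewrite ltW// ltNge; apply/negP/h.
have [g1 g2] := state_gibbs n.
have g y : 0 <= gibbs n y <= expR (- 1).
  apply/andP; split.
    rewrite gibbsE; have fin := finite_preimage1 cX inj.
    rewrite fsbig_finite/=; last exact: finite_fiber.
    by apply: sumr_ge0 => x _; exact: expR_ge0.
  apply: le_trans (gibbs_le y h) _.
  rewrite opprD expRD mulrA ler_piMl ?expR_ge0//.
  by rewrite expRN lnK ?posrE ?ltr0n// ler_pdivrMr ?ltr0n// mul1r ler_nat.
have := state_delta_bounds cX cphi inj hA om g1 g.
rewrite g2 => /andP[_]; rewrite (lecR 1) leNgt expRN invf_lt1 ?expR_gt0//.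
by rewrite expR_gt1 ltr01.
Qed.

Lemma kms_birkhoff_max n (N M : nat) : (0 < N)%N ->
  (forall y, N <= npreimages phi n y <= M)%N ->
  exists x, ln N%:R - 1 <= birkhoff n x * beta.
Proof.
move=> N0 hN; apply: contrapT => /forallNP h.
have {}h x : birkhoff n x * beta <= ln N%:R - 1.
  by rewrite ltW// ltNge; apply/negP/h.
have [g1 g2] := state_gibbs n.
have [B B0 FB] := compact_continuous_bounded cX cF.
(* A crude bound, to supply the upper half of the two-sided estimate that [state_delta_bounds] asks
   for. *)
have hB x : - (n%:R * B * `|beta|) <= birkhoff n x * beta.
  rewrite lerNl -mulNr; apply: le_trans (ler_norm _) _.
  rewrite normrM normrN ler_wpM2r//; apply: le_trans (ler_norm_sum _ _ _) _.
  rewrite -[n in leRHS]card_ord mulr_natl -sumr_const; apply: ler_sum => j _.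
  exact: FB.
have g y : expR 1 <= gibbs n y <= M%:R * expR (- - (n%:R * B * `|beta|)).
  have /andP[yN yM] := hN y; apply/andP; split; last first.
    apply: le_trans (gibbs_le y hB) _.
    by rewrite ler_wpM2r ?expR_ge0// ler_nat.
  apply: le_trans (gibbs_ge y h).
  rewrite opprB addrC expRD mulrA ler_peMl ?expR_ge0//.
  by rewrite expRN lnK ?posrE ?ltr0n// ler_pdivlMr ?ltr0n// mul1r ler_nat.
have := state_delta_bounds cX cphi inj hA om g1 g.
rewrite g2 => /andP[+ _]; rewrite (lecR _ 1) leNgt.
by rewrite expR_gt1 ltr01.
Qed.

End kms.

(** * Growth of the number of preimages *)

(** The limit is the infimum of a_n / n. Dividing n by k with remainder r gives a_n <= q a_k + a_r,
    hence a_n / n <= a_k / k + D / n with D independent of n. *)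
Lemma fekete (R : realType) (a : nat -> R) (B : R) :
  (forall n k, a (n + k)%N <= a n + a k) -> (forall n, - B * n%:R <= a n) ->
  cvgn (fun n => n%:R^-1 * a n).
Proof.
move=> sub lb; pose S := [set x | exists2 n, (0 < n)%N & x = n%:R^-1 * a n].
have Slb : has_lbound S.
  exists (- B) => _ [n n0 ->]; rewrite mulrC ler_pdivlMr ?ltr0n//; exact: lb.
have S0 : S !=set0 by exists (1%:R^-1 * a 1%N), 1%N.
have Sinf : has_inf S by [].
apply/cvg_ex; exists (inf S); apply/cvgrPdist_le => e e0.
have [_ [k k0 ->] hk] := inf_adherent (divr_gt0 e0 (ltr0n R 2)) Sinf.
(* The sum bounds a_r for every remainder r; |a_k| pays for replacing q by n / k. *)
pose D := `|a k| + \sum_(r < k) `|a r|.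
have D0 : 0 <= D by rewrite addr_ge0// sumr_ge0.
have aq q r : a (q * k + r)%N <= q%:R * a k + a r.
  elim: q => [|q IH]; first by rewrite mul0n add0n mul0r add0r.
  rewrite mulSn -addnA; apply: le_trans (sub _ _) _.
  by rewrite -natr1 mulrDl mul1r; lra.
have an n : a n <= n%:R * (k%:R^-1 * a k) + D.
  have kR : 0 < k%:R :> R by rewrite ltr0n.
  have rk : (n %% k < k)%N by rewrite ltn_mod.
  have h1 := aq (n %/ k)%N (n %% k)%N; rewrite -divn_eq in h1.
  have h2 : a (n %% k)%N <= \sum_(r < k) `|a r|.
    rewrite (bigD1 (Ordinal rk))//=; apply: le_trans (ler_norm _) _.
    by rewrite lerDl sumr_ge0.
  have nE : n%:R = (n %/ k)%:R * k%:R + (n %% k)%:R :> R.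
    by rewrite {1}(divn_eq n k) natrD natrM.
  have h3 : n%:R * (k%:R^-1 * a k) =
    (n %/ k)%:R * a k + (n %% k)%:R / k%:R * a k.
    by rewrite {1}nE; field; rewrite gt_eqF.
  have h4 : - `|a k| <= (n %% k)%:R / k%:R * a k.
    rewrite lerNl -mulNr; apply: le_trans (ler_norm _) _.
    rewrite normrM normrN (ger0_norm (divr_ge0 _ _))// ler_piMl//.
    by rewrite ler_pdivrMr// mul1r ler_nat ltnW.
  by rewrite /D h3; lra.
near=> n.
have n0 : (0 < n)%N by near: n; exists 1%N.
have nR : 0 < n%:R :> R by rewrite ltr0n.
have Sn : inf S <= n%:R^-1 * a n by apply: ge_inf => //; exists n.
have Dn : n%:R^-1 * D <= e / 2.
  rewrite mulrC ler_pdivrMr// mulrC -ler_pdivrMr ?divr_gt0//.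
  by near: n; exact: nbhs_infty_ger.
have h : n%:R^-1 * a n <= k%:R^-1 * a k + n%:R^-1 * D.
  rewrite mulrC ler_pdivrMr// mulrDl mulrC -[n%:R^-1 * D * _]mulrC mulVKf
    ?gt_eqF//.
rewrite ler_norml; apply/andP; split; lra.
Unshelve. all: by end_near. Qed.

Section extrema.
Variables (X : pointedType) (u : X -> nat).

Lemma min_valueP : exists2 x, u x = min_value u & forall y,
  (min_value u <= u y)%N.
Proof.
have [x xP] : exists x, forall y, (u x <= u y)%N.
  have ex : exists n, `[< exists x, u x = n >] by exists (u point);
    apply/asboolP; exists point.
  case: (ex_minnP ex) => n /asboolP[x <-] h; exists x => y.
  by apply: h; apply/asboolP; exists y.
have : (range u `&` lbound (range u)) (min_value u).
  by apply: xgetPex; exists (u x); split; [exists x|move=> _ [y _ <-];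
    exact: xP].
by move=> [[z _ <-] h]; exists z => // y; apply: h; exists y.
Qed.

Lemma max_valueP (K : nat) : (forall x, u x <= K)%N ->
  exists2 x, u x = max_value u & forall y, (u y <= max_value u)%N.
Proof.
move=> uK; have [x xP] : exists x, forall y, (u y <= u x)%N.
  have ex : exists n, `[< exists x, u x = n >] by exists (u point);
    apply/asboolP; exists point.
  have bd n : `[< exists x, u x = n >] -> (n <= K)%N by move=> /asboolP[x <-].
  case: (ex_maxnP ex bd) => n /asboolP[x <-] h; exists x => y.
  by apply: h; apply/asboolP; exists y.
have : (range u `&` ubound (range u)) (max_value u).
  by apply: xgetPex; exists (u x); split; [exists x|move=> _ [y _ <-];
    exact: xP].
by move=> [[z _ <-] h]; exists z => // y; apply: h; exists y.
Qed.

End extrema.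

Section growth.
Variables (R : realType) (X : pointedType) (phi : X -> X) (K : nat).
Hypotheses (fin : forall y, finite_set [set x | phi x = y])
  (leK : forall y, (npreimages phi 1 y <= K)%N)
  (surj : set_surj [set: X] [set: X] phi).
Local Notation N := (npreimages phi).

Let npreimages_add_le n y k (M : nat) : (forall x,
  N k x <= M)%N -> (N (n + k) y <= N n y * M)%N.
Proof.
move=> h; rewrite -(@ler_nat R) natrM (npreimages_sum R fin) (fiber_sum fin).
rewrite (npreimages_sum R fin n) !fsbig_finite/=;
  [|exact: finite_fiber|exact: finite_fiber].
rewrite mulr_suml; apply: ler_sum => x _.
by rewrite -(npreimages_sum R fin) mul1r ler_nat.
Qed.

Let npreimages_add_ge n y k (M : nat) : (forall x,
  M <= N k x)%N -> (N n y * M <= N (n + k) y)%N.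
Proof.
move=> h; rewrite -(@ler_nat R) natrM (npreimages_sum R fin (n +
  k)) (fiber_sum fin).
rewrite (npreimages_sum R fin n) !fsbig_finite/=;
  [|exact: finite_fiber|exact: finite_fiber].
rewrite mulr_suml; apply: ler_sum => x _.
by rewrite -(npreimages_sum R fin) mul1r ler_nat.
Qed.

Lemma npreimages_le n y : (N n y <= K ^ n)%N.
Proof.
elim: n y => [|n IH] y.
  rewrite -(@ler_nat R) (npreimages_sum R fin) (_ : [set _ | _] = [set y])//.
  by rewrite fsbig_set1.
rewrite -add1n expnD expn1; apply: leq_trans (npreimages_add_le 1 y IH) _.
by rewrite leq_mul2r leK orbT.
Qed.

Lemma npreimages_gt0 n y : (0 < N n y)%N.
Proof.
have [x xy] : exists x, iter n phi x = y.
  elim: n y => [|n IH] y; first by exists y.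
  have [z _ zy] := surj (I : [set: X] y); have [x xz] := IH z.
  by exists x; rewrite iterS xz.
rewrite cardfs_gt0; apply/fset0Pn; exists x.
by rewrite in_fset_set ?inE//; exact: finite_fiber.
Qed.

Let mn n := min_value (N n).
Let mx n := max_value (N n).

Let mnP n : exists2 x, N n x = mn n & forall y, (mn n <= N n y)%N.
Proof. exact: min_valueP. Qed.

Let mxP n : exists2 x, N n x = mx n & forall y, (N n y <= mx n)%N.
Proof. exact: max_valueP (npreimages_le n). Qed.

Lemma min_value_gt0 n : (0 < mn n)%N.
Proof. by have [x <- _] := mnP n; exact: npreimages_gt0. Qed.

Lemma max_value_ge n : (mn n <= mx n)%N.
Proof. by have [x <- _] := mnP n; have [_ _] := mxP n; apply. Qed.

Let mx_gt0 n : (0 < mx n)%N.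
Proof. exact: leq_trans (min_value_gt0 n) (max_value_ge n). Qed.

Let lnM (a b : nat) : (0 < a)%N -> (0 < b)%N ->
  ln (a * b)%:R = ln a%:R + ln b%:R :> R.
Proof. by move=> a0 b0; rewrite natrM lnM ?posrE ?ltr0n. Qed.

Let ln_le (a b : nat) : (0 < a)%N -> (a <= b)%N -> ln a%:R <= ln b%:R :> R.
Proof.
by move=> a0 ab; rewrite ler_ln ?posrE ?ltr0n ?ler_nat// (leq_trans a0).
Qed.

(** The minimum is supermultiplicative, so minus its logarithm is subadditive; K^n gives the linear
    lower bound. *)
Lemma min_growth_cvg :
  n%:R^-1 * ln (mn n)%:R @[n --> \oo] --> min_growth R phi.
Proof.
have h : cvgn (fun n => n%:R^-1 * - ln (mn n)%:R : R).
  apply: (@fekete R (fun n => - ln (mn n)%:R) (ln K%:R)) => [n k|n].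
    rewrite -opprD lerN2 -lnM ?min_value_gt0//; apply: ln_le.
      by rewrite muln_gt0 !min_value_gt0.
    have [y <- _] := mnP (n + k); have [_ _ h1] := mnP k.
    apply: leq_trans (npreimages_add_ge n y h1); rewrite leq_mul2r.
    by have [_ _ ->] := mnP n; rewrite orbT.
  rewrite mulNr lerN2; have [x <- _] := mnP n.
  have := npreimages_le n x.
  have K0 : (0 < K)%N by exact: leq_trans (npreimages_gt0 1 point) (leK point).
  move=> /(ln_le (npreimages_gt0 n x)) h; apply: le_trans h _.
  by rewrite natrX lnXn ?ltr0n// mulr_natr.
have h' : cvgn (fun n => n%:R^-1 * ln (mn n)%:R : R).
  rewrite (_ : (fun n => _) = - (fun n => n%:R^-1 * - ln (mn n)%:R)).
    exact: is_cvgN.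
  by apply/funext => n;
    rewrite -[RHS]/(- (n%:R^-1 * - ln (mn n)%:R)) mulrN opprK.
exact: h'.
Qed.

(** The maximum is submultiplicative, and at least 1 by surjectivity, so its logarithm is bounded
    below by 0. *)
Lemma max_growth_cvg :
  n%:R^-1 * ln (mx n)%:R @[n --> \oo] --> max_growth R phi.
Proof.
have h' : cvgn (fun n => n%:R^-1 * ln (mx n)%:R : R).
  apply: (@fekete R _ 0) => [n k|n].
    rewrite -lnM//; apply: ln_le => //.
    have [y <- _] := mxP (n + k); have [_ _ h1] := mxP k.
    apply: leq_trans (npreimages_add_le n y h1) _; rewrite leq_mul2r.
    by have [_ _ ->] := mxP n; rewrite orbT.
  by rewrite oppr0 mul0r ln_ge0// ler1n.
exact: h'.
Qed.

End growth.

(** * The Riesz-Markov theorem and invariant measures *)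

Section bumps.
Variables (R : realType) (X : metricType R).
Implicit Types (U : set X).

(* The distance to the complement of [U], capped at [1] because that complement
   may be empty. *)
Definition cdist U (x : X) : R := inf ([set 1] `|` [set mdist x a | a in ~` U]).

Let cdist_has_inf U x : has_inf ([set 1] `|` [set mdist x a | a in ~` U]).
Proof.
split; first by exists 1; left.
by exists 0 => _ [->|[a _ <-]]; [exact: ler01|exact: mdist_ge0].
Qed.

Lemma cdist_ge0 U x : 0 <= cdist U x.
Proof.
apply: lb_le_inf; first by have [] := cdist_has_inf U x.
by move=> _ [->|[a _ <-]]; [exact: ler01|exact: mdist_ge0].
Qed.

Lemma cdist_out U x : ~ U x -> cdist U x = 0.
Proof.
move=> Ux; apply/eqP; rewrite eq_le cdist_ge0 andbT.
apply: ge_inf; first by have [] := cdist_has_inf U x.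
by right; exists x => //; rewrite mdistxx.
Qed.

Lemma cdist_gt0 U x : open U -> U x -> 0 < cdist U x.
Proof.
move=> oU Ux; have /nbhs_ballP[r r0 rU] : nbhs x U by exact: open_nbhs_nbhs.
apply: (@lt_le_trans _ _ (Num.min 1 r)); first by rewrite lt_min ltr01.
apply: lb_le_inf; first by have [] := cdist_has_inf U x.
move=> _ [->|[a aU <-]]; first by rewrite ge_min lexx.
rewrite ge_min; apply/orP; right; rewrite leNgt; apply/negP => h; apply: aU.
by apply: rU; rewrite ballEmdist.
Qed.

Lemma cdist_lip U x y : cdist U x <= cdist U y + mdist x y.
Proof.
rewrite -lerBlDr; apply: lb_le_inf; first by have [] := cdist_has_inf U y.
have lbx := (cdist_has_inf U x).2.
move=> _ [->|[a aU <-]]; rewrite lerBlDr.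
  by apply: le_trans (_ : 1 <= _); [apply: ge_inf => //;
    left|rewrite lerDl mdist_ge0].
apply: (@le_trans _ _ (mdist x a)); first by apply: ge_inf => //; right;
  exists a.
by rewrite addrC metric_triangle.
Qed.

Lemma cdist_continuous U : continuous (cdist U).
Proof.
move=> x; apply/cvgrPdist_lt => e e0.
have h : nbhs x [set y | mdist x y < e].
  exact: (@mdist_near R X (nbhs x) _ X id x cvg_id e e0).
apply: filterS h => y /= xy.
have := cdist_lip U x y; have := cdist_lip U y x; rewrite (metric_sym y x).
by rewrite ltr_norml => h1 h2; apply/andP; split; lra.
Qed.

(** For [U] open, these continuous functions increase with n to the indicator of [U]. *)
Definition bump U (n : nat) (x : X) : R := Num.min 1 (n%:R * cdist U x).

Lemma bump_continuous U n : continuous (bump U n).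
Proof.
move=> x; apply: (@continuous_min R X (cst 1) (fun x => n%:R * cdist U x)).
  exact: cvg_cst.
by apply: cvgM; [exact: cvg_cst|exact: cdist_continuous].
Qed.

Lemma bump_ge0 U n x : 0 <= bump U n x.
Proof. by rewrite le_min ler01 mulr_ge0 ?cdist_ge0. Qed.

Lemma bump_le U n x : bump U n x <= \1_U x.
Proof.
rewrite indicE; have [Ux|Ux] := boolP (x \in U); first by rewrite ge_min lexx.
rewrite /bump cdist_out ?mulr0 ?ge_min ?lexx ?orbT//.
by move=> h; move: Ux; rewrite mem_set.
Qed.

Lemma bump_nd U x m n : (m <= n)%N -> bump U m x <= bump U n x.
Proof.
move=> mn; rewrite le_min ge_min lexx/= ge_min; apply/orP; right.
by rewrite ler_wpM2r ?cdist_ge0// ler_nat.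
Qed.

Lemma bump_eventually1 U x : open U -> U x ->
  exists n, forall m, (n <= m)%N -> bump U m x = 1.
Proof.
move=> oU Ux; have d0 := cdist_gt0 oU Ux.
exists (Num.truncn (cdist U x)^-1).+1 => m nm; apply/min_idPl.
rewrite -ler_pdivrMr// mul1r ltW//;
  apply: lt_le_trans (_ : (Num.truncn (cdist U x)^-1).+1%:R <= _).
  exact: truncnS_gt.
by rewrite ler_nat.
Qed.

End bumps.

Section borel_integration.
Variables (R : realType) (X : pointedMetricType R).
Hypothesis cX : compact [set: X].

Lemma open_borel (U : set X) : open U -> measurable (U : set (borel X)).
Proof. by move=> oU; exact: sub_sigma_algebra. Qed.

Lemma continuous_borel (f : X -> R) : continuous f ->
  measurable_fun [set: borel X] f.
Proof.
move=> cf; apply: (@measurability _ _ (borel X) (measurableTypeR R) setT f _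
  (measurable_realfun.RGenOpens.measurableE R)) => _ [_ [a [b ->]] <-].
rewrite setTI; apply: open_borel.
by apply: open_comp; [move=> x _; exact: cf|exact: interval_open].
Qed.

Variable mu : probability (borel X) R.

Lemma bounded_borel_integrable (f : X -> R) (B : R) :
  measurable_fun [set: borel X] f -> (forall x, `|f x| <= B) ->
  mu.-integrable [set: borel X] (EFin \o f).
Proof.
move=> mf fB; apply: measurable_bounded_integrable => //.
  exact: (le_lt_trans (@probability_le1 _ _ _ mu setT measurableT) (ltry 1)).
exists B; split; first exact: num_real.
by move=> M BM x _; apply: le_trans (fB x) (ltW BM).
Qed.

Lemma continuous_borel_integrable (f : X -> R) : continuous f ->
  mu.-integrable [set: borel X] (EFin \o f).
Proof.
move=> cf; have [B _ fB] := compact_continuous_bounded cX cf.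
exact: bounded_borel_integrable (continuous_borel cf) fB.
Qed.

Lemma Rintegral_probability_cst (c : R) : \int[mu]_x c = c.
Proof.
rewrite Rintegral_cst// [X in fine X](_ : _ = 1%E) ?mulr1//.
exact: probability_setT.
Qed.

End borel_integration.

Lemma clip_sum (R : realType) (n : nat) (t : R) : 0 <= t <= n%:R ->
  \sum_(k < n) Num.min 1 (Num.max 0 (t - k%:R)) = t.
Proof.
suff h m : 0 <= t -> \sum_(k < m) Num.min 1 (Num.max 0 (t - k%:R)) =
  Num.min m%:R t.
  by move=> /andP[t0 tn]; rewrite h// min_r.
move=> t0; elim: m => [|m IH]; first by rewrite big_ord0 min_l.
rewrite big_ord_recr /= IH -natr1.
by rewrite !minEle !maxEle; repeat case: ifP; lra.
Qed.

Lemma indicator_sum_le (R : realType) (n : nat) (t : R) : 0 <= t ->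
  \sum_(k < n) (k%:R < t)%R%:R <= t + 1.
Proof.
(* The term k = 0 accounts for the 1; the terms with k >= 1 count at most t integers. *)
move=> t0; case: n => [|n]; first by rewrite big_ord0 addr_ge0.
rewrite big_ord_recl.
suff h : \sum_(k < n) ((lift ord0 k)%:R < t)%R%:R <= t.
  by rewrite addrC lerD// lern1 leq_b1.
suff h m : \sum_(k < m) ((k.+1)%:R < t)%R%:R <= Num.min m%:R t.
  by apply: le_trans (h n) _; rewrite ge_min lexx orbT.
elim: m => [|m IH]; first by rewrite big_ord0 le_min lexx t0.
rewrite big_ord_recr /=; move: IH; rewrite -natr1.
by rewrite !minEle; case: ltP => //=; repeat case: ifP; lra.
Qed.
Section riesz.
Variables (R : realType) (X : pointedMetricType R) (L : (X -> R) -> R).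
Hypotheses (cX : compact [set: X])
  (LD : forall f g : X -> R, continuous f -> continuous g ->
     L (fun x => f x + g x) = L f + L g)
  (LZ : forall (c : R) (f : X -> R), continuous f -> L (fun x =>
    c * f x) = c * L f)
  (L_ge0 : forall f : X -> R, continuous f -> (forall x, 0 <= f x) -> 0 <= L f)
  (L1 : L (fun=> 1) = 1).

Let ccst (c : R) : continuous (fun _ : X => c).
Proof. by move=> x; exact: cvg_cst. Qed.

Let cD (f g : X -> R) : continuous f -> continuous g -> continuous (fun x =>
  f x + g x).
Proof. by move=> cf cg x; apply: cvgD; [exact: cf|exact: cg]. Qed.

Let cZ (c : R) (f : X -> R) : continuous f -> continuous (fun x => c * f x).
Proof. by move=> cf x; apply: cvgM; [exact: cvg_cst|exact: cf]. Qed.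

Let L_cst (c : R) : L (fun=> c) = c.
Proof.
rewrite (_ : (fun=> c) = (fun x : X => c * (fun=> 1) x)).
  by rewrite LZ ?L1 ?mulr1//; exact: ccst.
by apply/funext => x; rewrite mulr1.
Qed.

Let L_le (f g : X -> R) : continuous f -> continuous g ->
  (forall x, f x <= g x) -> L f <= L g.
Proof.
move=> cf cg fg; have cNf := @cZ (-1) f cf.
have := L_ge0 (cD cg cNf); rewrite LD// LZ// mulN1r subr_ge0; apply => x.
by rewrite mulN1r subr_ge0.
Qed.

Let L_sum (n : nat) (f : 'I_n -> X -> R) : (forall i, continuous (f i)) ->
  L (fun x => \sum_(i < n) f i x) = \sum_(i < n) L (f i).
Proof.
elim: n f => [|n IH] f cf.
  under eq_fun do rewrite big_ord0.
  by rewrite big_ord0 L_cst.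
under eq_fun do rewrite big_ord_recr.
by rewrite LD ?big_ord_recr/= ?IH//; exact: continuous_sum.
Qed.

(* No positivity is asked of the test functions, which spares taking positive
   parts when subtracting a small constant. *)
Definition below (U : set X) : set R :=
  [set L f | f in [set f : X -> R | continuous f /\ forall x, f x <= \1_U x]].

Definition open_mass (U : set X) : R := sup (below U).

Let below_has_sup U : has_sup (below U).
Proof.
split.
  by exists 0, (fun=> 0); [split; [exact: ccst|move=> x;
    rewrite indicE]|exact: L_cst].
exists 1 => _ [f [cf fU] <-]; rewrite -L1; apply: L_le => // x.
by apply: le_trans (fU x) _; rewrite indicE lern1 leq_b1.
Qed.

Lemma open_mass_ub U (f : X -> R) : continuous f -> (forall x, f x <= \1_U x) ->
  L f <= open_mass U.
Proof.
by move=> cf fU; apply: ub_le_sup; [exact: (below_has_sup U).2|exists f].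
Qed.

Let open_mass_le U (c : R) : (forall f : X -> R, continuous f -> (forall x,
  f x <= \1_U x) ->
  L f <= c) -> open_mass U <= c.
Proof.
move=> h; apply: ge_sup; first exact: (below_has_sup U).1.
by move=> _ [f [cf fU] <-]; exact: h.
Qed.

Let open_mass_ge0 U : 0 <= open_mass U.
Proof.
rewrite -(L_cst 0); apply: open_mass_ub; first exact: ccst.
by move=> x; rewrite indicE.
Qed.

Let open_mass_le1 U : open_mass U <= 1.
Proof.
apply: open_mass_le => f cf fU; rewrite -L1; apply: L_le => // x.
by apply: le_trans (fU x) _; rewrite indicE lern1 leq_b1.
Qed.

Let open_massT : open_mass setT = 1.
Proof.
apply/eqP; rewrite eq_le open_mass_le1/= -{1}L1; apply: open_mass_ub => //.
by move=> x; rewrite indicE in_setT.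
Qed.

Let open_mass0 : open_mass set0 = 0.
Proof.
apply/eqP; rewrite eq_le open_mass_ge0 andbT; apply: open_mass_le => f cf f0.
by rewrite -(L_cst 0); apply: L_le => // x; have := f0 x;
  rewrite indicE in_set0.
Qed.

Let indic_le (U V : set X) (x : X) : U `<=` V -> \1_U x <= \1_V x :> R.
Proof.
move=> UV; rewrite !indicE ler_nat; case: (boolP (x \in U)) => // xU.
by rewrite mem_set//; apply: UV; move: xU; rewrite inE.
Qed.

Let open_mass_mono U V : U `<=` V -> open_mass U <= open_mass V.
Proof.
move=> UV; apply: open_mass_le => f cf fU; apply: open_mass_ub => // x.
by apply: le_trans (fU x) _; exact: indic_le.
Qed.

(** A function f below the indicator of the union is, by compactness, below a finite sum of bumps
    plus e, and [L] of each bump is at most the mass of its set. *)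
Let open_mass_subadd (U : (set X)^nat) : (forall n, open (U n)) ->
  ((open_mass (\bigcup_n U n))%:E <= \sum_(i <oo) (open_mass (U i))%:E)%E.
Proof.
move=> oU; apply/lee_addgt0Pr => e e0.
(* Masses are at most 1, so only a sum at most 1, hence finite, needs an argument. *)
have [S|S] := leP (\sum_(i <oo) (open_mass (U i))%:E)%E (1%:E)%E; last first.
  apply: le_trans (_ : (1%:E <= _)%E); first by rewrite lee_fin.
  by rewrite (le_trans (ltW S))// leeDl// lee_fin ltW.
have Sfin : (\sum_(i <oo) (open_mass (U i))%:E)%E \is a fin_num.
  rewrite ge0_fin_numE; first exact: le_lt_trans S (ltry _).
  by apply: nneseries_ge0 => n _ _; rewrite lee_fin.
rewrite -(fineK Sfin) -EFinD lee_fin; apply: open_mass_le => f cf fU.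
(* The index n is both the number of sets and the steepness, so that [G n] increases with n; e makes
   it exceed f strictly, also off the union, where f <= 0. *)
pose G n x := \sum_(i < n) bump (U i) n x + e.
have cG n : continuous (G n).
  apply: cD; last exact: ccst.
  by apply: continuous_sum => i; exact: bump_continuous.
(* Dini's argument: the [G n] increase to a limit above [f]. *)
have [n fG] : exists n, forall x, f x < G n x.
  have := cX; rewrite compact_cover => /(_ nat setT (fun n =>
    [set x | 0 < G n x - f x])).
  case.
  - move=> n _; apply: (@open_comp X R (fun x => G n x - f x) [set r | 0 < r]).
      by move=> x _; apply: cvgB; [exact: cG|exact: cf].
    exact: open_gt.
  - move=> x _; have := fU x; rewrite indicE.
    have [xU|xU] := boolP (x \in \bigcup_n U n).
      move: xU; rewrite inE => -[i _ Uix] f1.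
      have [n nP] := bump_eventually1 (oU i) Uix.
      exists (maxn n i.+1) => //=; rewrite subr_gt0 /G.
      have lt : (i < maxn n i.+1)%N by rewrite leq_max leqnn orbT.
      rewrite (bigD1 (Ordinal lt))//= nP ?leq_maxl//.
      apply: le_lt_trans f1 _; rewrite -addrA ltrDl ltr_wpDl//.
      by apply: sumr_ge0 => j _; exact: bump_ge0.
    move=> f0; exists 0%N => //=; rewrite subr_gt0 /G big_ord0 add0r.
    exact: le_lt_trans f0 e0.
  move=> D _ DP; exists (\max_(i <- D) i)%N => x.
  have [n nD /=] := DP x I; rewrite subr_gt0 => h; apply: lt_le_trans h _.
  have nm : (n <= \max_(i <- D) i)%N by rewrite (big_rem n)//= leq_maxl.
  rewrite /G lerD2r (big_ord_widen _ (fun i => bump (U i) n x) nm).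
  rewrite big_mkcond /=; apply: ler_sum => i _; case: ifP => _.
    exact: bump_nd.
  exact: bump_ge0.
have cb (i : 'I_n) : continuous (bump (U i) n) by exact: bump_continuous.
apply: (@le_trans _ _ (L (G n))); first by apply: L_le => // x; exact: ltW.
rewrite LD ?L_cst ?L_sum//; last exact: continuous_sum.
rewrite lerD2r -lee_fin fineK//.
apply: (@le_trans _ _ (\sum_(0 <= i < n) (open_mass (U i))%:E)%E).
  rewrite big_mkord sumEFin lee_fin; apply: ler_sum => i _.
  by apply: open_mass_ub => // x; exact: bump_le.
apply: nneseries_lim_ge => i _ _; by rewrite lee_fin.
Qed.

Definition covers (B : set X) : set R :=
  [set open_mass U | U in [set U | open U /\ B `<=` U]].

Definition riesz_outer (B : set X) : \bar R := (inf (covers B))%:E.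

Let covers_has_inf B : has_inf (covers B).
Proof.
split; first by exists (open_mass setT), setT => //; split; [exact: openT|].
by exists 0 => _ [U _ <-].
Qed.

Let riesz_outer_lb B U : open U -> B `<=` U ->
  (riesz_outer B <= (open_mass U)%:E)%E.
Proof.
move=> oU BU; rewrite lee_fin; apply: ge_inf; first exact: (covers_has_inf B).2.
by exists U.
Qed.

Let riesz_outer_ge B (c : R) : (forall U,
  open U -> B `<=` U -> c <= open_mass U) ->
  (c%:E <= riesz_outer B)%E.
Proof.
move=> h; rewrite lee_fin; apply: lb_le_inf; first exact: (covers_has_inf B).1.
by move=> _ [U [oU BU] <-]; exact: h.
Qed.

Lemma riesz_outer_open U : open U -> riesz_outer U = (open_mass U)%:E.
Proof.
move=> oU; apply/eqP; rewrite eq_le riesz_outer_lb//=.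
by apply: riesz_outer_ge => V oV UV; exact: open_mass_mono.
Qed.

Let outer0 : riesz_outer set0 = 0%E.
Proof. by rewrite riesz_outer_open ?open_mass0//; exact: open0. Qed.

Let outer_ge0 B : (0 <= riesz_outer B)%E.
Proof. by apply: riesz_outer_ge. Qed.

Let outer_mono : {homo riesz_outer : B C / B `<=` C >-> (B <= C)%E}.
Proof.
move=> B C BC; apply: riesz_outer_ge => U oU CU.
by rewrite -lee_fin; apply: riesz_outer_lb => //; exact: subset_trans CU.
Qed.

Let outer_subadd : sigma_subadditive riesz_outer.
Proof.
move=> B; apply/lee_addgt0Pr => e e0.
have /choice[U UP] : forall n, exists U, [/\ open U, B n `<=` U &
    ((open_mass U)%:E <= riesz_outer (B n) + (e / (2 ^ n.+1)%:R)%:E)%E].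
  move=> n; have d0 : 0 < e / (2 ^ n.+1)%:R.
    by rewrite divr_gt0// ltr0n expn_gt0.
  have [_ [V [oV BV] <-] h] := inf_adherent d0 (covers_has_inf (B n)).
  by exists V; split => //; rewrite -EFinD lee_fin ltW.
have oU n : open (U n) by have [] := UP n.
apply: le_trans (epsilon_trick xpredT _ (ltW e0)); last by [].
apply: le_trans (_ : (open_mass (\bigcup_n U n))%:E <= _)%E.
  apply: riesz_outer_lb; first exact: bigcup_open.
  by apply: subset_bigcup => n _; have [] := UP n.
apply: le_trans (open_mass_subadd oU) _; apply: lee_nneseries.
  by move=> n _ _; rewrite lee_fin.
by move=> n _; have [] := UP n.
Qed.

HB.instance Definition _ := isOuterMeasure.Build R X riesz_outer
  outer0 outer_ge0 outer_mono outer_subadd.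

(** Given an open V containing E and f below the indicator of V meet U, the open set {f < e}
    replaces the complement of a support: W contains E minus U, as f <= 0 there. If g is below the
    indicator of W, then f + g - e is below that of V. *)
Lemma open_caratheodory U : open U -> caratheodory_measurable riesz_outer U.
Proof.
move=> oU; apply: le_caratheodory_measurable => E.
apply: riesz_outer_ge => V oV EV.
apply/ler_addgt0Pr => e e0.
have oVU : open (V `&` U) by exact: openI.
have h1 : inf (covers (E `&` U)) <= open_mass (V `&` U).
  by rewrite -lee_fin; apply: riesz_outer_lb => // x [Ex Ux]; split=> //;
    exact: EV.
rewrite -lerBrDr; apply: le_trans h1 _; apply: open_mass_le => f cf fVU.
pose W := V `&` [set x | f x < e].
have oW : open W.
  apply: openI => //; apply: (@open_comp X R f [set r | r < e]);
    last exact: open_lt.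
  by move=> x _; exact: cf.
have h2 : inf (covers (E `&` ~` U)) <= open_mass W.
  rewrite -lee_fin; apply: riesz_outer_lb => // x [Ex Ux]; split;
    first exact: EV.
  apply: le_lt_trans (fVU x) _; rewrite indicE memNset//; by move=> [].
rewrite lerBrDr -lerBrDl; apply: le_trans h2 _; apply: open_mass_le => g cg gW.
rewrite lerBrDl -lerBlDr.
have -> : L f + L g - e = L (fun x => (f x + g x) + - e).
  by rewrite LD ?LD ?L_cst//; exact: cD.
apply: open_mass_ub; first by apply: cD; [exact: cD|exact: ccst].
move=> x; have := fVU x; have := gW x; rewrite !indicE.
have [xW|xW] := boolP (x \in W).
  move: xW; rewrite inE => -[Vx fx] g1 _; rewrite (mem_set Vx).
  by move: fx g1 => /=; lra.
have [xV|xV] := boolP (x \in V); last first.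
  rewrite memNset; last by move=> [Vx _]; move: xV; rewrite mem_set.
  by rewrite /= mulr0n; lra.
have : (x \in V `&` U)%:R <= 1 :> R by rewrite lern1 leq_b1.
by rewrite /= mulr0n mulr1n; lra.
Qed.

Definition riesz_measure (B : set (borel X)) : \bar R := riesz_outer B.

Lemma borel_caratheodory (B : set (borel X)) : measurable B ->
  caratheodory_measurable riesz_outer B.
Proof.
apply: smallest_sub => [|U oU]; last exact: open_caratheodory.
split.
- exact: caratheodory_measurable_set0.
- by move=> C hC; rewrite setTD; exact: caratheodory_measurable_setC.
- by move=> C hC; exact: caratheodory_measurable_bigcup.
Qed.

Let riesz_sigma_additive : semi_sigma_additive riesz_measure.
Proof.
move=> B mB tB mUB; apply: (@caratheodory_measure_sigma_additive R X
  riesz_outer) => //.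
  by move=> n; exact: borel_caratheodory.
exact: borel_caratheodory.
Qed.

HB.instance Definition _ := isMeasure.Build _ (borel X) R riesz_measure
  outer0 outer_ge0 riesz_sigma_additive.

Let rieszT : riesz_measure setT = 1%E.
Proof. by rewrite /riesz_measure riesz_outer_open ?open_massT//;
  exact: openT. Qed.

HB.instance Definition _ :=
  Measure_isProbability.Build _ (borel X) R riesz_measure rieszT.

(* Layer cake: [n f] is the sum over [k < n] of the truncations [f_k] of
   [n f - k] to [0, 1], and [f_k] lies below the indicator of [n f > k]. *)
Let int_below (mu : probability (borel X) R) :
  (forall U : set X, open U -> mu U = (open_mass U)%:E) ->
  forall f : X -> R, continuous f -> (forall x, 0 <= f x <= 1) ->
  L f <= \int[mu]_x f x.
Proof.
move=> muE f cf f01; apply/ler_addgt0Pr => e e0.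
(* The layers lose at most 1 on n f, hence at most 1 / n <= e on f. *)
pose n := (Num.truncn e^-1).+1.
have nR : 0 < n%:R :> R by rewrite ltr0n.
have ne : 1 <= n%:R * e.
  rewrite mulrC -ler_pdivrMl// mulr1 ltW//; exact: truncnS_gt.
pose fk (k : 'I_n) x : R := Num.min 1 (Num.max 0 (n%:R * f x + - k%:R)).
have cfk k : continuous (fk k).
  move=> x; apply: (@continuous_min R X (cst 1) (fun x =>
    Num.max 0 (n%:R * f x + - k%:R))).
    exact: cvg_cst.
  apply: (@continuous_max R X (cst 0) (fun x => n%:R * f x + - k%:R)).
    exact: cvg_cst.
  by apply: cD; [exact: cZ|exact: ccst].
have nf x : 0 <= n%:R * f x <= n%:R.
  have /andP[f0 f1] := f01 x; rewrite mulr_ge0//=.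
  by rewrite ler_piMr.
have LE : n%:R * L f = \sum_(k < n) L (fk k).
  rewrite -L_sum// -LZ//; congr L; apply/funext => x.
  by rewrite clip_sum.
pose U (k : 'I_n) := [set x | k%:R < n%:R * f x].
have oU k : open (U k).
  apply: (@open_comp X R (fun x => n%:R * f x) [set r | k%:R < r]);
    last exact: open_gt.
  by move=> x _; exact: cZ.
have mU k : measurable (U k : set (borel X)) by exact: open_borel.
have LU k : L (fk k) <= \int[mu]_x (\1_(U k) x).
  rewrite /Rintegral integral_indic//= setIT muE//=;
    apply: open_mass_ub => // x.
  rewrite indicE; case: (boolP (x \in U k)) => xU; first by rewrite ge_min lexx.
  rewrite /fk max_l ?ge_min ?lexx ?orbT// subr_le0 leNgt.
  by apply/negP => h; move: xU; rewrite mem_set.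
have iU k : mu.-integrable [set: borel X] (EFin \o \1_(U k)).
  exact: integrable_indic.
have S m (g : 'I_m -> X -> R) : (forall k,
  mu.-integrable [set: borel X] (EFin \o g k)) ->
    mu.-integrable [set: borel X] (EFin \o (fun x => \sum_(k < m) g k x)) /\
    \int[mu]_x (\sum_(k < m) g k x) = \sum_(k < m) \int[mu]_x (g k x).
  elim: m g => [|m IH] g ig.
    rewrite big_ord0; under eq_fun do rewrite big_ord0.
    split; last by rewrite Rintegral_cst// mul0r.
    exact: continuous_borel_integrable (@ccst 0).
  have [h1 h2] := IH (fun k => g (widen_ord (leqnSn m) k)) (fun k => ig _).
  have E : (fun x => \sum_(k < m.+1) g k x) =
      (fun x => \sum_(k < m) g (widen_ord (leqnSn m) k) x + g ord_max x).
    by apply/funext => x; rewrite big_ord_recr.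
  rewrite big_ord_recr /= -h2 E.
  split; last by rewrite -RintegralD.
  exact: (integrableD measurableT h1 (ig ord_max)).
have [h1 h2] := S _ _ iU.
have if_ := continuous_borel_integrable cX mu cf.
have inf_ : mu.-integrable [set: borel X] (EFin \o (fun x => n%:R * f x + 1)).
  apply: (continuous_borel_integrable cX); apply: cD; [exact: cZ|exact: ccst].
have : n%:R * L f <= n%:R * \int[mu]_x f x + 1.
  rewrite LE; apply: le_trans (ler_sum _ (fun k _ => LU k)) _.
  rewrite -h2; apply: le_trans (le_Rintegral measurableT h1 inf_ _) _.
    move=> x _; have /andP[nf0 _] := nf x.
    apply: le_trans (indicator_sum_le n nf0); apply: ler_sum => k _.
    rewrite indicE (_ : (x \in U k) = (k%:R < n%:R * f x))//.
    by apply/idP/idP; rewrite inE.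
  rewrite RintegralD//;
    last exact: (continuous_borel_integrable cX mu (@ccst 1)).
    by rewrite RintegralZl// Rintegral_probability_cst.
  by apply: (continuous_borel_integrable cX); exact: cZ.
move=> h; rewrite -(ler_pM2l nR) mulrDr; apply: le_trans h _.
by rewrite lerD2l.
Qed.

Let int_le (mu : probability (borel X) R) :
  (forall U : set X, open U -> mu U = (open_mass U)%:E) ->
  forall f : X -> R, continuous f -> L f <= \int[mu]_x f x.
Proof.
move=> muE f cf; have [B B0 fB] := compact_continuous_bounded cX cf.
have B2 : 0 < 2 * B by lra.
(* An affine rescaling into [0, 1]; [L] and the integral both respect it, since both send 1 to 1. *)
pose g x := (2 * B)^-1 * (f x + B).
have cfB : continuous (fun x => f x + B) by apply: cD => //; exact: ccst.
have cg : continuous g by exact: cZ.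
have g01 x : 0 <= g x <= 1.
  have := fB x; rewrite ler_norml /g => /andP[h1 h2]; apply/andP; split.
    by rewrite mulr_ge0 ?invr_ge0 ?(ltW B2)//; lra.
  by rewrite mulrC ler_pdivrMr// mul1r; lra.
have := int_below muE cg g01.
have iB := continuous_borel_integrable cX mu (@ccst B).
have i_ := continuous_borel_integrable cX mu cf.
rewrite /g (LZ _ cfB) (LD cf (@ccst B)) L_cst.
rewrite RintegralZl//; last exact: continuous_borel_integrable.
rewrite ler_pM2l ?invr_gt0// RintegralD// Rintegral_probability_cst.
by rewrite lerD2r.
Qed.

Theorem riesz_markov : exists mu : probability (borel X) R,
  forall f : X -> R, continuous f -> \int[mu]_x f x = L f.
Proof.
exists riesz_measure => f cf.
have muE U : open U -> riesz_measure U = (open_mass U)%:E :=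
  @riesz_outer_open U.
apply/eqP; rewrite eq_le (int_le muE cf) andbT.
have cNf : continuous (fun x => -1 * f x) by exact: cZ.
(* The inequality for -f is the converse of the one for f. *)
have := int_le muE cNf; rewrite LZ// RintegralZl//; last first.
  exact: continuous_borel_integrable.
by rewrite !mulN1r lerN2.
Qed.

End riesz.

Section invariance.
Variables (R : realType) (X : pointedMetricType R) (phi : X -> X).
Hypotheses (cX : compact [set: X]) (cphi : continuous phi).

(** Monotone convergence along bumps gives the equality on open sets. These are stable under
    intersection and generate the Borel sets, so [mu] and its image under [phi] agree. *)
Lemma invariant_of_integral (mu : probability (borel X) R) :
  (forall f : X -> R, continuous f -> \int[mu]_x f (phi x) = \int[mu]_x f x) ->
  forall B : set (borel X), measurable B -> mu (phi @^-1` B) = mu B.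
Proof.
move=> h.
have mphi : measurable_fun [set: borel X] (phi : borel X -> borel X).
  apply: (@measurability _ _ (borel X) (borel X) setT phi (@open X)) => //.
  move=> _ [U oU <-]; rewrite setTI; apply: open_borel.
  by apply: open_comp => // x _; exact: cphi.
have mono (U : set X) (psi : X -> X) : open U -> continuous psi ->
    (\int[mu]_x (bump U n (psi x))%:E)%E @[n --> \oo] --> mu (psi @^-1` U).
  move=> oU cpsi.
  have oV : open (psi @^-1` U) by apply: open_comp => // x _; exact: cpsi.
  have cb n : continuous (fun x => bump U n (psi x)).
    by move=> x; apply: continuous_comp; [exact: cpsi|exact: bump_continuous].
  rewrite -[psi @^-1` U]setIT -integral_indic//; last exact: open_borel.
  have := @cvg_monotone_convergence _ (borel X) R mu setT measurableT
    (fun n x => (bump U n (psi x))%:E).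
  rewrite (_ : (fun x => limn (fun n => (bump U n (psi x))%:E)) =
     (fun x => (\1_(psi @^-1` U) x)%:E)).
    apply.
    - by move=> n; apply/measurable_realfun.measurable_EFinP;
        exact: continuous_borel.
    - by move=> n x _; rewrite lee_fin bump_ge0.
    - by move=> x _ m n mn; rewrite lee_fin bump_nd.
  apply/funext => x; apply/cvg_lim => //; rewrite indicE.
  have [xU|xU] := boolP (x \in psi @^-1` U).
    move: xU; rewrite inE /= => Ux; have [N NP] := bump_eventually1 oU Ux.
    apply: cvg_near_cst; exists N => // n /= Nn.
    by rewrite NP.
  apply: cvg_near_cst; exists 0%N => // n _.
  rewrite /bump cdist_out ?mulr0 ?min_r ?ler01//.
  by move=> Ux; move: xU; rewrite mem_set.
have openE (U : set X) : open U -> mu (phi @^-1` U) = mu U.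
  move=> oU; have h1 := mono U phi oU cphi.
  have h2 := mono U id oU (fun x => cvg_id).
  rewrite preimage_id in h2.
  suff E : (fun n => \int[mu]_x (bump U n (phi x))%:E)%E =
      (fun n => \int[mu]_x (bump U n x)%:E)%E.
    by rewrite E in h1; exact: (cvg_unique (@ereal_hausdorff R) h1 h2).
  apply/funext => n.
  have cb : continuous (bump U n) := @bump_continuous R X U n.
  have cbp : continuous (fun x => bump U n (phi x)).
    by move=> x; apply: continuous_comp; [exact: cphi|exact: cb].
  have i1 := continuous_borel_integrable cX mu cb.
  have i2 := continuous_borel_integrable cX mu cbp.
  rewrite -[LHS]fineK; last exact: (integrable_fin_num measurableT i2).
  rewrite -[RHS]fineK; last exact: (integrable_fin_num measurableT i1).
  by congr (_%:E); exact: h.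
move=> B mB.
(* The measure structure of a pushforward depends on the measurability proof, so
   it is not inferred. *)
pose nu := measure_function_pushforward__canonical__measure_function_Measure mu
  mphi.
apply: (@measure_unique _ R (borel X) (@open X) (fun=> setT) _ _ _ _ nu mu) =>
  //.
- exact: openI.
- by move=> _; exact: openT.
- by rewrite bigcup_const//; exists 0%N.
- by move=> _; apply: (le_lt_trans (@probability_le1 _ _ _ mu setT measurableT)
  (ltry 1)).
Qed.

End invariance.

Section ultralimit.
Variables (R : realType) (X : pointedMetricType R) (phi : X ->
  X) (x_ : nat -> X).
Hypotheses (cX : compact [set: X]) (cphi : continuous phi).

Let avg (f : X -> R) (n : nat) : R := n%:R^-1 * birkhoff phi f n (x_ n).

Let avg_bounded (f : X -> R) (B : R) n : (forall x,
  `|f x| <= B) -> `|avg f n| <= B.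
Proof.
move=> fB; have B0 : 0 <= B by apply: le_trans (fB point).
rewrite /avg normrM ger0_norm ?invr_ge0//; case: n => [|n].
  by rewrite invr0 mul0r.
rewrite mulrC ler_pdivrMr ?ltr0n//; apply: le_trans (ler_norm_sum _ _ _) _.
rewrite -[n.+1 in leRHS]card_ord mulr_natr -sumr_const; apply: ler_sum => j _.
exact: fB.
Qed.

(** An ultrafilter finer than the filter at infinity makes the averages of all continuous functions
    converge at once, being bounded; linearity, positivity and one-sided bounds pass to the
    limit. *)
Lemma ultralimit_functional : exists L : (X -> R) -> R,
  [/\ forall f g : X -> R, continuous f -> continuous g ->
        L (fun x => f x + g x) = L f + L g,
      forall (c : R) (f : X -> R), continuous f -> L (fun x =>
        c * f x) = c * L f,
      forall f : X -> R, continuous f -> (forall x, 0 <= f x) -> 0 <= L f,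
      L (fun=> 1) = 1 &
      forall f : X -> R, continuous f -> L (fun x => f (phi x)) = L f] /\
  forall (f : X -> R) (c : nat -> R) (l : R), continuous f ->
    c n @[n --> \oo] --> l -> (forall n,
      (0 < n)%N -> avg f n <= c n) -> L f <= l.
Proof.
have [U [UU sU]] := ultraFilterLemma (eventually_filter).
have PU : ProperFilter U by exact: ultra_proper.
have cv f : continuous f -> exists l : R, avg f n @[n --> U] --> l.
  move=> cf; have [B B0 fB] := compact_continuous_bounded cX cf.
  have UB : U (avg f @^-1` `[- B, B]%classic).
    apply: filterE => n; have := avg_bounded n fB.
    by rewrite ler_norml /= in_itv /= => ->.
  have [l [_ hl]] := @segment_compact R (- B) B _ (fmap_proper_filter (avg f)
    PU) UB.
  (* A cluster point along an ultrafilter is a limit: if the preimage of V were not in [U], its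
     complement would be, and it would still have to meet V. *)
  exists l => V Vl; have [//|UV] := in_ultra_setVsetC (avg f @^-1` V) UU.
  by have [z [nVz Vz]] := hl (~` V) V UV Vl.
pose L f := lim (avg f n @[n --> U]).
have Lcv f : continuous f -> avg f n @[n --> U] --> L f.
  by move=> /cv[l hl]; rewrite /L (cvg_lim _ hl).
have LE f l : avg f n @[n --> U] --> l -> L f = l by move=> hl;
  exact: cvg_lim hl.
have oo (a : nat -> R) (l : R) : a n @[n --> \oo] --> l -> a n @[n --> U] --> l.
  by move=> al V /al; exact: sU.
have pos : U [set n | (0 < n)%N] by apply: sU; exists 1%N.
exists L; split; [split|].
- move=> f g cf cg; apply: LE.
  have -> : avg (fun x => f x + g x) = (fun n => avg f n + avg g n).
    by apply/funext => n; rewrite /avg /birkhoff big_split mulrDr.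
  by apply: cvgD; exact: Lcv.
- move=> c f cf; apply: LE.
  have -> : avg (fun x => c * f x) = (fun n => c * avg f n).
    by apply/funext => n; rewrite /avg /birkhoff -mulr_sumr mulrCA.
  by apply: cvgM; [exact: cvg_cst|exact: Lcv].
- move=> f cf f0; apply: (ler_cvg_to (cvg_cst (0 : R)) (Lcv _ cf)).
  apply: filterE => n; rewrite mulr_ge0 ?invr_ge0//.
  by apply: sumr_ge0 => j _; exact: f0.
- apply: LE; apply: cvg_near_cst; apply: filterS pos => n /= n0.
  by rewrite /avg /birkhoff sumr_const card_ord mulVf// pnatr_eq0 -lt0n.
- move=> f cf; apply: LE.
  have [B B0 fB] := compact_continuous_bounded cX cf.
  (* The two Birkhoff sums telescope; the averages differ by at most 2 B / n. *)
  have -> : avg (fun x => f (phi x)) =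
      (fun n => avg f n + n%:R^-1 * (f (iter n phi (x_ n)) - f (x_ n))).
    apply/funext => n; rewrite /avg -mulrDr; congr (_ * _).
    have -> : birkhoff phi (fun x => f (phi x)) n (x_ n) =
        \sum_(j < n) f (iter j.+1 phi (x_ n)) by [].
    rewrite /birkhoff; move: (x_ n) => x; elim: n => [|n IH].
      by rewrite !big_ord0 subrr addr0.
    by rewrite !big_ord_recr /= IH; ring.
  rewrite -[L f]addr0; apply: cvgD; first exact: Lcv.
  apply: oo; apply/cvgrPdist_le => e e0; near=> n.
  have n0 : (0 < n)%N by near: n; exists 1%N.
  rewrite sub0r normrN normrM ger0_norm ?invr_ge0// mulrC ler_pdivrMr ?ltr0n//.
  apply: le_trans (ler_normB _ _) _; apply: le_trans (lerD (fB _) (fB _)) _.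
  rewrite mulrC -ler_pdivrMr//.
  by near: n; exact: nbhs_infty_ger.
- move=> f c l cf cl h.
  apply: (ler_cvg_to (Lcv _ cf) (oo _ _ cl)).
  exact: filterS pos.
Unshelve. all: by end_near. Qed.
End ultralimit.

Theorem theorem6p8 (R : realType) (X : pointedMetricType R) (phi : X -> X)
    (F : X -> R) (beta : R)
    (A : unitalCstarAlgebra R) (iota : (gpd phi -> R[i]) -> A) :
  compact [set: X] -> continuous phi -> locally_injective phi ->
  set_surj [set: X] [set: X] phi ->
  continuous F -> beta != 0 ->
  is_reduced_Cstar_algebra iota ->
  (exists (alpha : R -> A -> A) (omega : A -> R[i]),
     is_alpha iota F alpha /\ is_KMS_state alpha beta omega) ->
  exists mu : probability (borel X) R,
    (forall B : set (borel X), measurable B -> mu (phi @^-1` B) = mu B) /\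
    min_growth R phi <= beta * \int[mu]_x F x <= max_growth R phi.
Proof.
move=> cX cphi inj surj cF _ hA [alpha [omega [al kms]]].
have [K hK] := finite_preimage cX inj.
have fin := finite_preimage1 cX inj.
have leK y : (npreimages phi 1 y <= K)%N by have [] := hK y.
pose mn n := min_value (npreimages phi n).
pose mx n := max_value (npreimages phi n).
have mnP n y : (mn n <= npreimages phi n y)%N.
  by have [_ _] := min_valueP (npreimages phi n); apply.
have mxP n y : (npreimages phi n y <= mx n)%N.
  by have [_ _] := max_valueP (npreimages_le R fin leK n); apply.
have mn0 n : (0 < mn n)%N := min_value_gt0 fin surj n.
have mnx n : (mn n <= mx n)%N := max_value_ge R fin leK n.
have mx0 n : (0 < mx n)%N := leq_trans (mn0 n) (mnx n).
have /choice[x xP] : forall n, exists x,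
  birkhoff phi F n x * beta <= ln (mx n)%:R + 1.
  by move=> n; apply: (kms_birkhoff_min cX cphi inj hA cF al kms (mx0 n) (mxP
    n)).
have /choice[y yP] : forall n, exists y,
  ln (mn n)%:R - 1 <= birkhoff phi F n y * beta.
  move=> n; apply: (@kms_birkhoff_max _ _ _ _ _ cX cphi inj hA F beta alpha
    omega cF al kms n (mn n) (mx n)) => // z.
  by rewrite mnP mxP.
have cvg1 : n%:R^-1 @[n --> \oo] --> (0 : R).
  apply/cvgrPdist_le => e e0; near=> n.
  have n0 : (0 < n)%N by near: n; exists 1%N.
  rewrite sub0r normrN ger0_norm ?invr_ge0// invf_ple ?posrE ?ltr0n//.
  by near: n; exact: nbhs_infty_ger.
have gmx : n%:R^-1 * ln (mx n)%:R @[n --> \oo] --> max_growth R phi.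
  exact: max_growth_cvg leK surj.
have gmn : n%:R^-1 * ln (mn n)%:R @[n --> \oo] --> min_growth R phi.
  exact: min_growth_cvg leK surj.
have cmx : n%:R^-1 * (ln (mx n)%:R + 1) @[n --> \oo] --> max_growth R phi.
  under eq_fun do rewrite mulrDr mulr1.
  by rewrite -[max_growth _ _]addr0; apply: cvgD.
have cmn : n%:R^-1 * - (ln (mn n)%:R - 1) @[n --> \oo] --> - min_growth R phi.
  under eq_fun do rewrite opprD opprK mulrDr mulr1 mulrN.
  by rewrite -[- min_growth _ _]addr0; apply: cvgD => //; exact: cvgN.
have mM : min_growth R phi <= max_growth R phi.
  apply: (ler_cvg_to gmn gmx); near=> n.
  by rewrite ler_wpM2l ?invr_ge0// ler_ln ?posrE ?ltr0n// ler_nat.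
have [L1 [[D1 Z1 P1 I1 V1] B1]] := @ultralimit_functional R X phi x cX.
have [L2 [[D2 Z2 P2 I2 V2] B2]] := @ultralimit_functional R X phi y cX.
have cbF : continuous (fun x => beta * F x).
  by move=> z; apply: cvgM; [exact: cvg_cst|exact: cF].
have cNbF : continuous (fun x => - beta * F x).
  by move=> z; apply: cvgM; [exact: cvg_cst|exact: cF].
have birkZ (c : R) n z : birkhoff phi (fun x =>
  c * F x) n z = birkhoff phi F n z * c.
  by rewrite /birkhoff -mulr_sumr mulrC.
have a_le : beta * L1 F <= max_growth R phi.
  rewrite -Z1//; apply: B1 cbF cmx _ => n n0.
  by rewrite birkZ ler_wpM2l ?invr_ge0.
(* The ultralimit carries upper bounds, so this lower bound is obtained through - beta F. *)
have b_ge : min_growth R phi <= beta * L2 F.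
  rewrite -lerN2 -mulNr -Z2//; apply: B2 cNbF cmn _ => n n0.
  by rewrite birkZ mulrN ler_wpM2l ?invr_ge0// lerN2.
(* If neither functional alone fits, the value of [L1] is below the interval and that of [L2] above
   it; t then makes the combination exactly [min_growth]. *)
have [t [/andP[t0 t1] tP]] : exists t, 0 <= t <= 1 /\
    min_growth R phi <= beta * (t * L1 F + (1 - t) * L2 F) <= max_growth R phi.
  have [ma|am] := leP (min_growth R phi) (beta * L1 F).
    by exists 1; rewrite ler01 lexx subrr mul0r addr0 mul1r ma a_le.
  have [bM|Mb] := leP (beta * L2 F) (max_growth R phi).
    by exists 0; rewrite ler01 lexx subr0 mul0r add0r mul1r b_ge bM.
  have ba : 0 < beta * L2 F - beta * L1 F by lra.
  exists ((beta * L2 F - min_growth R phi) / (beta * L2 F - beta * L1 F)).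
  split; first apply/andP; first split.
  - by apply: divr_ge0; lra.
  - by rewrite ler_pdivrMr//; lra.
  - suff -> : beta * ((beta * L2 F - min_growth R phi) / (beta * L2 F - beta *
      L1 F) * L1 F +
      (1 - (beta * L2 F - min_growth R phi) / (beta * L2 F - beta * L1 F)) * L2
        F) =
      min_growth R phi by rewrite lexx mM.
    by field; rewrite gt_eqF.
pose L f := t * L1 f + (1 - t) * L2 f.
have [mu muE] : exists mu : probability (borel X) R,
    forall f : X -> R, continuous f -> \int[mu]_x f x = L f.
  apply: (riesz_markov cX).
  - by move=> f g cf cg; rewrite /L D1// D2//; ring.
  - by move=> c f cf; rewrite /L Z1// Z2//; ring.
  - move=> f cf f0; rewrite /L addr_ge0// mulr_ge0 ?subr_ge0 ?P1 ?P2//.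
  - by rewrite /L I1 I2; ring.
exists mu; split; last by rewrite muE.
apply: (invariant_of_integral cX cphi) => f cf.
have cfp : continuous (fun x => f (phi x)).
  by move=> z; apply: continuous_comp; [exact: cphi|exact: cf].
by rewrite !muE// /L V1// V2.
Unshelve. all: by end_near. Qed.
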